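(* Let $(M,\Pi)$ be a Poisson manifold, $C\subset M$ a submanifold and $E\subset TM|_C$ a subbundle such that $F:=TC\cap E$ is a constant rank, involutive distribution on $C$. Let $D|_C$ be a subbundle of $TM|_C$ with $F\subset D|_C\subset E$ and $$\sharp E^{\circ}\subset TC+D|_C .$$ Let $A$ be a submanifold of $M$ containing $C$ such that $TA|_C=TC+D|_C$, and assume that $D|_C$ can be extended to an integrable distribution $D\subset TA$ on $A$ such that $$(\mathcal{L}_{X_i}\Pi)|_C\subset E\wedge TM|_C,$$ where $\{X_i\}$ is an extension from $A$ to $M$ of a (local) frame of sections of $D$. Assume that the quotient $\underline{C}:=C/F$ of $C$ by the foliation integrating $F$ is a smooth manifold (so that $C\to\underline{C}$ is a submersion). Then $\underline{C}=C/F$ inherits a Poisson manifold structure.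
   Context: A Poisson manifold is a smooth manifold $M$ with a Lie bracket $\{\cdot,\cdot\}$ on $C^\infty(M)$ satisfying $\{f,gh\}=\{f,g\}h+g\{f,h\}$; equivalently, a bivector field $\Pi\in\Gamma(\wedge^2TM)$ with vanishing Schouten bracket $[\Pi,\Pi]=0$, where $\{f,g\}=\Pi(df,dg)$. The map $\sharp:T^*M\to TM$ is contraction with $\Pi$. For a subbundle $E\subset TM|_C$, $E^\circ\subset T^*M|_C$ denotes its annihilator. $E\wedge TM|_C$ denotes the subbundle of $\wedge^2TM|_C$ spanned by elements $e\wedge v$ with $e\in E$, $v\in TM|_C$. $\mathcal{L}$ is the Lie derivative. Meaning of ''inherits'': functions on $\underline{C}$ are identified, via pullback, with the functions on $C$ that are constant along the leaves of $F$. For such functions $f,g$ and any point $p\in C$, there exist a neighbourhood $U$ of $p$ in $M$ and extensions $\tilde f,\tilde g\in C^\infty(U)$ of $f|_{C\cap U},g|_{C\cap U}$ whose differentials annihilate $E$ at all points of $C\cap U$ and annihilate $D$ at all points of $A\cap U$. The inherited bracket of $f$ and $g$ is, near $p$ in $C$, the restriction $\{\tilde f,\tilde g\}|_{C}$ of the Poisson bracket of $M$; that it is well defined (independent of the extensions), constant along the leaves of $F$, and a Poisson bracket on $C^\infty(\underline{C})$ is what is asserted. *)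

(* Defs.v *)
From mathcomp Require Import all_boot all_order all_algebra.
From mathcomp Require Import all_classical all_reals all_analysis.
From Stdlib Require Import Relations.
Import Order.TTheory GRing.Theory Num.Theory.
Import numFieldNormedType.Exports.

Set Implicit Arguments.
Unset Strict Implicit.
Unset Printing Implicit Defensive.

Local Open Scope classical_set_scope.
Local Open Scope ring_scope.

(* Smoothness on an open subset V of R^n. *)

Fixpoint Ck (R : realType) (n k : nat) (V : set 'rV[R]_n)
    (f : 'rV[R]_n -> R) : Prop :=
  (forall x, V x -> {for x, continuous f}) /\
  (if k is k'.+1 then
     forall i : 'I_n, (forall x, V x -> derivable f x (delta_mx 0 i)) /\
                      Ck k' V (fun x => 'D_(delta_mx 0 i) f x)
   else True).

Definition Cinf (R : realType) (n : nat) (V : set 'rV[R]_n)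
    (f : 'rV[R]_n -> R) : Prop := forall k, Ck k V f.

(* Smooth manifolds. *)

Record chart (R : realType) (T : topologicalType) (n : nat) := Chart {
  cdom : set T;
  cmap : T -> 'rV[R]_n;
  cinv : 'rV[R]_n -> T }.

Definition ccoord (R : realType) (T : topologicalType) (n : nat)
    (c : chart R T n) (i : 'I_n) : T -> R := fun x => cmap c x 0 i.

(* Only the restrictions of cmap to cdom and of cinv to cmap @` cdom matter. *)
Definition is_chart (R : realType) (T : topologicalType) (n : nat)
    (c : chart R T n) : Prop :=
  [/\ open (cdom c),
      open (cmap c @` cdom c),
      forall x, cdom c x -> cinv c (cmap c x) = x,
      forall x, cdom c x -> {for x, continuous (cmap c)} &
      forall x, cdom c x -> {for cmap c x, continuous (cinv c)}].

Definition smooth_transition (R : realType) (T : topologicalType) (n : nat)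
    (c c' : chart R T n) : Prop :=
  forall i, Cinf (cmap c @` (cdom c `&` cdom c')) (ccoord c' i \o cinv c).

(* The atlas is indexed by the points of the manifold: chart_at p is a chart
   around p. Every atlas contains a subatlas of this form, and the charts of
   the maximal atlas are recovered by compatible_chart. *)
Record manifold (R : realType) (n : nat) := Manifold {
  carrier :> topologicalType;
  chart_at : carrier -> chart R carrier n;
  chart_atP : forall p, is_chart (chart_at p);
  mem_chart_at : forall p, cdom (chart_at p) p;
  chart_at_smooth : forall p r, smooth_transition (chart_at p) (chart_at r);
  manifold_hausdorff : hausdorff_space carrier;
  manifold_second_countable : @second_countable carrier }.

Definition compatible_chart (R : realType) (m : nat) (M : manifold R m)
    (c : chart R M m) : Prop :=
  is_chart c /\
  forall p, smooth_transition (chart_at p) c /\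
            smooth_transition c (chart_at p).

Definition smooth (R : realType) (m : nat) (M : manifold R m) (U : set M)
    (f : M -> R) : Prop :=
  forall p, Cinf (cmap (chart_at p) @` (cdom (chart_at p) `&` U))
                 (f \o cinv (chart_at p)).

(* T_pM and T*_pM are both identified with 'rV[R]_m by means of the bases
   d/dx^i and dx^i given by the coordinates x^i = mcoord p i of the preferred
   chart at p. All tensors at p (vectors, covectors, bivectors, fibres of
   bundles) are expressed in these bases. *)
Definition mcoord (R : realType) (m : nat) (M : manifold R m) (p : M)
    (i : 'I_m) : M -> R := ccoord (chart_at p) i.

Definition differential (R : realType) (m : nat) (M : manifold R m) (f : M -> R)
    (p : M) : 'rV[R]_m :=
  \row_i 'D_(delta_mx 0 i) (f \o cinv (chart_at p)) (cmap (chart_at p) p).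

Definition pairing (R : realType) (m : nat) (v alpha : 'rV[R]_m) : R :=
  (v *m alpha^T) 0 0.

Definition vf_act (R : realType) (m : nat) (M : manifold R m)
    (X : M -> 'rV[R]_m) (f : M -> R) : M -> R :=
  fun p => pairing (X p) (differential f p).

Definition smooth_vf (R : realType) (m : nat) (M : manifold R m) (U : set M)
    (X : M -> 'rV[R]_m) : Prop :=
  forall (W : set M) (f : M -> R), open W -> W `<=` U ->
    smooth W f -> smooth W (vf_act X f).

(* The i-th component of [X, Y] at p is [X, Y](x^i). *)
Definition lie_bracket (R : realType) (m : nat) (M : manifold R m)
    (X Y : M -> 'rV[R]_m) (p : M) : 'rV[R]_m :=
  \row_i (vf_act X (vf_act Y (mcoord p i)) p
          - vf_act Y (vf_act X (mcoord p i)) p).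

(* Bivector fields: Pi p is the matrix of components Pi^{ij} at p. *)

Definition sharp (R : realType) (m : nat) (M : manifold R m)
    (Pi : M -> 'M[R]_m) (p : M) (alpha : 'rV[R]_m) : 'rV[R]_m :=
  alpha *m Pi p.

Definition pbracket (R : realType) (m : nat) (M : manifold R m)
    (Pi : M -> 'M[R]_m) (f g : M -> R) : M -> R :=
  fun p => pairing (sharp Pi p (differential f p)) (differential g p).

Definition bivector_field (R : realType) (m : nat) (M : manifold R m)
    (Pi : M -> 'M[R]_m) : Prop :=
  (forall p, (Pi p)^T = - Pi p) /\
  (forall (W : set M) (f g : M -> R), open W ->
     smooth W f -> smooth W g -> smooth W (pbracket Pi f g)).

(* The component [P, Q]^{ijk} at p of the Schouten bracket of two bivector
   fields (up to the sign convention), evaluated on dx^i, dx^j, dx^k: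
   the cyclic sum of P^{il} d_l Q^{jk} + Q^{il} d_l P^{jk}. *)
Definition schouten (R : realType) (m : nat) (M : manifold R m)
    (P Q : M -> 'M[R]_m) (p : M) (i j k : 'I_m) : R :=
  let x := mcoord p in
  let t i j k := pbracket P (x i) (pbracket Q (x j) (x k)) p +
                 pbracket Q (x i) (pbracket P (x j) (x k)) p in
  t i j k + t j k i + t k i j.

Definition poisson_bivector (R : realType) (m : nat) (M : manifold R m)
    (Pi : M -> 'M[R]_m) : Prop :=
  bivector_field Pi /\ forall p i j k, schouten Pi Pi p i j k = 0.

(* (L_X Pi)(dx^i, dx^j)
     = X (Pi(dx^i, dx^j)) - Pi(L_X dx^i, dx^j) - Pi(dx^i, L_X dx^j),
   where L_X dx^i = d(X x^i). *)
Definition lie_derivative (R : realType) (m : nat) (M : manifold R m)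
    (X : M -> 'rV[R]_m) (Pi : M -> 'M[R]_m) (p : M) : 'M[R]_m :=
  let x := mcoord p in
  \matrix_(i, j) (vf_act X (pbracket Pi (x i) (x j)) p
                  - pbracket Pi (vf_act X (x i)) (x j) p
                  - pbracket Pi (x i) (vf_act X (x j)) p).

(* E wedge T_pM: the finite sums of e_i /\ v_i with e_i in E, where e_i, v_i
   are the rows of e, v and e /\ v has components e^i v^j - v^i e^j. *)
Definition wedge_tangent (R : realType) (m : nat) (E : set 'rV[R]_m) :
    set 'M[R]_m :=
  [set B | exists (l : nat) (e v : 'M[R]_(l, m)),
     (forall i, E (row i e)) /\ B = e^T *m v - v^T *m e].

(* Embedded submanifolds. *)

Definition slice_chart (R : realType) (m : nat) (M : manifold R m) (k : nat)
    (S : set M) (c : chart R M m) : Prop :=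
  compatible_chart c /\
  forall x, cdom c x ->
    (S x <-> forall i : 'I_m, (k <= i)%N -> ccoord c i x = 0).

Definition submanifold (R : realType) (m : nat) (M : manifold R m) (k : nat)
    (S : set M) : Prop :=
  (k <= m)%N /\
  forall p, S p -> exists c : chart R M m, slice_chart k S c /\ cdom c p.

(* T_pS for a k-dimensional submanifold S: the span of the first k coordinate
   vectors of a slice chart. *)
Definition tangent (R : realType) (m : nat) (M : manifold R m) (k : nat)
    (S : set M) (p : M) : set 'rV[R]_m :=
  [set v | exists c : chart R M m, [/\ slice_chart k S c, cdom c p &
     forall i : 'I_m, (k <= i)%N ->
       pairing v (differential (ccoord c i) p) = 0]].

(* Subbundles of TM|_S, given by their fibres B x for x in S. Smooth sections
   over S are the restrictions of locally defined smooth vector fields of M. *)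

Definition local_frame (R : realType) (m : nat) (M : manifold R m) (r : nat)
    (S : set M) (B : M -> set 'rV[R]_m) (U : set M)
    (X : 'I_r -> M -> 'rV[R]_m) : Prop :=
  (forall i, smooth_vf U (X i)) /\
  (forall x, S x -> U x ->
     row_free (\matrix_i X i x) /\
     B x = [set v | (v <= \matrix_i X i x)%MS]).

Definition subbundle (R : realType) (m : nat) (M : manifold R m) (r : nat)
    (S : set M) (B : M -> set 'rV[R]_m) : Prop :=
  forall p, S p -> exists (U : set M) (X : 'I_r -> M -> 'rV[R]_m),
    [/\ open U, U p & local_frame S B U X].

Definition tangent_distribution (R : realType) (m : nat) (M : manifold R m)
    (k r : nat) (S : set M) (B : M -> set 'rV[R]_m) : Prop :=
  subbundle r S B /\ forall x, S x -> B x `<=` tangent k S x.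

(* For B contained in TS, the restriction to S of [X, Y] only depends on the
   restrictions of X and Y, and is the Lie bracket of these on S. *)
Definition involutive_distribution (R : realType) (m : nat) (M : manifold R m)
    (S : set M) (B : M -> set 'rV[R]_m) : Prop :=
  forall (U : set M) (X Y : M -> 'rV[R]_m), open U ->
    smooth_vf U X -> smooth_vf U Y ->
    (forall x, S x -> U x -> B x (X x)) ->
    (forall x, S x -> U x -> B x (Y x)) ->
    forall x, S x -> U x -> B x (lie_bracket X Y x).

(* B is tangent to a foliation of the k-dimensional submanifold S: around each
   point there is a foliated chart of S (extended to a slice chart of M) in
   which B is spanned by the first r coordinate vectors. *)
Definition integrable_distribution (R : realType) (m : nat) (M : manifold R m)
    (k r : nat) (S : set M) (B : M -> set 'rV[R]_m) : Prop :=
  forall p, S p -> exists c : chart R M m,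
    [/\ slice_chart k S c, cdom c p &
        forall x, S x -> cdom c x ->
          B x = [set v | forall i : 'I_m, (r <= i)%N ->
                           pairing v (differential (ccoord c i) x) = 0]].

(* The leaves of the foliation of S integrating B. Leaves need not be embedded
   in M; a leaf is a maximal union of overlapping connected embedded integral
   manifolds. *)

Definition connected_integral_manifold (R : realType) (m : nat)
    (M : manifold R m) (r : nat) (S : set M) (B : M -> set 'rV[R]_m)
    (N : set M) : Prop :=
  [/\ submanifold r N, N `<=` S, connected N &
      forall x, N x -> tangent r N x = B x].

Definition same_leaf (R : realType) (m : nat) (M : manifold R m) (r : nat)
    (S : set M) (B : M -> set 'rV[R]_m) : M -> M -> Prop :=
  clos_refl_trans M (fun x y => exists N : set M,
    [/\ connected_integral_manifold r S B N, N x & N y]).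

(* Maps q : S -> Q from a submanifold S of M; the values of q outside S are
   irrelevant. *)

Definition smooth_map (R : realType) (m n : nat) (M : manifold R m)
    (Q : manifold R n) (S : set M) (q : M -> Q) : Prop :=
  forall (p : M) (W : set Q) (f : Q -> R), S p -> open W -> W (q p) ->
    smooth W f ->
    exists (U : set M) (h : M -> R),
      [/\ open U, U p, smooth U h &
          forall x, S x -> U x -> W (q x) /\ h x = f (q x)].

(* dq_p(v) = w, i.e. w f = v (f o q) for all functions f smooth near q p; here
   h is any smooth extension of f o q from S to a neighbourhood of p. *)
Definition differential_at (R : realType) (m n : nat) (M : manifold R m)
    (Q : manifold R n) (S : set M) (q : M -> Q) (p : M)
    (v : 'rV[R]_m) (w : 'rV[R]_n) : Prop :=
  forall (W : set Q) (f : Q -> R) (U : set M) (h : M -> R),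
    open W -> W (q p) -> smooth W f -> open U -> U p -> smooth U h ->
    (forall x, S x -> U x -> W (q x) /\ h x = f (q x)) ->
    pairing v (differential h p) = pairing w (differential f (q p)).

Definition submersion (R : realType) (m n : nat) (M : manifold R m)
    (Q : manifold R n) (k : nat) (S : set M) (q : M -> Q) : Prop :=
  smooth_map S q /\
  forall p, S p -> forall w : 'rV[R]_n,
    exists2 v, tangent k S p v & differential_at S q p v w.

(* Q is the quotient of S by the foliation integrating B. *)
Definition leaf_space (R : realType) (m n : nat) (M : manifold R m)
    (k r : nat) (S : set M) (B : M -> set 'rV[R]_m) (Q : manifold R n)
    (q : M -> Q) : Prop :=
  [/\ submersion k S q,
      q @` S = setT &
      forall x y, S x -> S y -> (q x = q y <-> same_leaf r S B x y)].

(* Poisson brackets on C^oo(Q); the values of br on non-smooth functions are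
   irrelevant. *)
Definition poisson_bracket (R : realType) (n : nat) (Q : manifold R n)
    (br : (Q -> R) -> (Q -> R) -> Q -> R) : Prop :=
  [/\ forall f g, smooth setT f -> smooth setT g -> smooth setT (br f g),
      forall (a : R) f g h, smooth setT f -> smooth setT g -> smooth setT h ->
        br (fun x => a * f x + g x) h = (fun x => a * br f h x + br g h x),
      forall f g, smooth setT f -> smooth setT g ->
        br f g = (fun x => - br g f x),
      forall f g h, smooth setT f -> smooth setT g -> smooth setT h ->
        (fun x => br f (br g h) x + br g (br h f) x + br h (br f g) x)
        = (fun=> 0) &
      forall f g h, smooth setT f -> smooth setT g -> smooth setT h ->
        br f (fun x => g x * h x)
        = (fun x => br f g x * h x + g x * br f h x)].

(* h is an extension to U of u|_{C n U} whose differential annihilates E along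
   C and D along A. *)
Definition adapted_extension (R : realType) (m : nat) (M : manifold R m)
    (C A : set M) (E D : M -> set 'rV[R]_m) (u : M -> R) (U : set M)
    (h : M -> R) : Prop :=
  [/\ smooth U h,
      forall x, C x -> U x -> h x = u x,
      forall x, C x -> U x -> forall v, E x v ->
        pairing v (differential h x) = 0 &
      forall x, A x -> U x -> forall v, D x v ->
        pairing v (differential h x) = 0].

(* Adapted extensions exist locally, and any choice of them computes the
   bracket of Q by restricting the bracket of M to C. *)
Definition inherits_poisson (R : realType) (m n : nat) (M : manifold R m)
    (Pi : M -> 'M[R]_m) (C A : set M) (E D : M -> set 'rV[R]_m)
    (Q : manifold R n) (q : M -> Q) : Prop :=
  (forall (f : Q -> R) (p : M), smooth setT f -> C p ->
     exists (U : set M) (h : M -> R),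
       [/\ open U, U p & adapted_extension C A E D (f \o q) U h]) /\
  exists br : (Q -> R) -> (Q -> R) -> Q -> R,
    poisson_bracket br /\
    forall (f g : Q -> R) (U : set M) (f' g' : M -> R),
      smooth setT f -> smooth setT g -> open U ->
      adapted_extension C A E D (f \o q) U f' ->
      adapted_extension C A E D (g \o q) U g' ->
      forall x, C x -> U x -> br f g (q x) = pbracket Pi f' g' x.

(* Main.v *)
Require Import Defs.
From HB Require Import structures.
From mathcomp Require Import all_boot all_order all_algebra.
From mathcomp Require Import all_classical all_reals all_analysis.
From mathcomp Require Import ring lra.
From Stdlib Require Import Relations.
Import Order.TTheory GRing.Theory Num.Theory.
Import numFieldNormedType.Exports.

(** Reduction of a Poisson manifold along a submanifold C with the help of a
    larger submanifold A, foliated by D, such that TA = TC + D on C.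

    Call a local function on M adapted to f when it extends f o q from C and its
    differential annihilates E along C and D along A. The bracket of f and g is
    the restriction to C of {f', g'} for adapted extensions f' and g'.

    Adapted extensions exist ([adapted_extension_exists]). The distribution F is
    TC /\ D, the kernel of the projection from C to the local quotient A/D; so
    f o q, which is constant on leaves, is locally the pull-back of a function on
    A/D. This gives an extension constant along D, whose derivatives along
    E /\ TA = D vanish, and the remaining derivatives along E are cancelled by
    adding multiples of functions vanishing on A.

    The bracket is independent of the extensions ([adapted_bracket_unique]): the
    Hamiltonian vectors of adapted extensions lie in TC + D by the assumption on
    the annihilator of E, and the difference of two extensions of the same
    function has zero derivative along TC and D.

    The restriction of {f', g'} to C has zero derivative along D
    ([adapted_bracket_invariant]): for a frame field X of D,
    X {f', g'} = (L_X Pi)(df', dg') + {X f', g'} + {f', X g'}, where the first term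
    vanishes because L_X Pi lies in the wedge of E and TM, and the others because
    X f' and X g' vanish on A. Hence it is constant on the leaves and descends to
    the quotient, where it is smooth because the submersion q has local sections
    ([smooth_descent]). The algebraic identities are inherited from M. The Jacobi
    identity uses once more that a Hamiltonian vector of an adapted extension
    only sees derivatives along TC + D.

    The geometric input is calculus: the inverse function theorem
    ([inverse_function]), which produces charts with prescribed coordinate
    functions ([chart_of_functions], [submersion_chart]), and the symmetry of
    second derivatives ([derive_comm]), which makes commutators of derivations
    derivations again ([commutator_derivation]). The latter gives the Jacobi
    identity on M and the formula for X {f', g'} from their expressions in
    coordinates. *)

Set Implicit Arguments.
Unset Strict Implicit.
Unset Printing Implicit Defensive.

Local Open Scope classical_set_scope.
Local Open Scope ring_scope.

(** * The mean value theorem in several variables *)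

Lemma derivable_along_line (R : realType) (V : normedModType R) (f : V -> R)
    (z v : V) (t : R) :
  derivable f (z + t *: v) v ->
  is_derive t 1 (fun s : R => f (z + s *: v)) ('D_v f (z + t *: v)).
Proof.
move=> df.
have E : (fun h : R => h^-1 *: (f (z + (h *: 1 + t) *: v) - f (z + t *: v)))
   = (fun h : R => h^-1 *: (f (h *: v + (z + t *: v)) - f (z + t *: v))).
  apply/funext => h; congr (_ *: (f _ - _)).
  by rewrite [h *: 1]mulr1 scalerDl addrCA.
apply: DeriveDef; first by rewrite /derivable /= E.
by rewrite /derive /= E.
Qed.

Lemma mean_value_line (R : realType) (V : normedModType R) (f : V -> R)
    (z v : V) (a : R) :
  (forall t, (0 <= t <= a) || (a <= t <= 0) -> derivable f (z + t *: v) v) ->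
  exists2 t, (0 <= t <= a) || (a <= t <= 0) &
    f (z + a *: v) - f z = a * 'D_v f (z + t *: v).
Proof.
move=> df.
have dg t : (0 <= t <= a) || (a <= t <= 0) ->
    is_derive t 1 (fun s : R => f (z + s *: v)) ('D_v f (z + t *: v)).
  by move=> /df; exact: derivable_along_line.
have cg (b c : R) : (forall t, t \in `[b, c]%R -> (0 <= t <= a) || (a <= t <= 0)) ->
    {within `[b, c], continuous (fun s : R => f (z + s *: v))}.
  move=> H; apply: derivable_within_continuous => t /H /dg.
  by case.
have [a0|a0] := leP 0 a.
  have [t||t ti E] := @MVT_segment R (fun s => f (z + s *: v))
      (fun s => 'D_v f (z + s *: v)) 0 a a0.
  - by rewrite in_itv /= => /andP[/ltW t0 /ltW ta]; apply: dg; rewrite t0 ta.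
  - by apply: cg => t; rewrite in_itv /= => ->.
  - exists t; first by move: ti; rewrite in_itv /= => ->.
    by move: E; rewrite scale0r addr0 subr0 mulrC.
have [t||t ti E] := @MVT_segment R (fun s => f (z + s *: v))
      (fun s => 'D_v f (z + s *: v)) a 0 (ltW a0).
- by rewrite in_itv /= => /andP[/ltW t0 /ltW ta]; apply: dg; rewrite t0 ta orbT.
- by apply: cg => t; rewrite in_itv /= => ->; rewrite orbT.
- exists t; first by move: ti; rewrite in_itv /= => ->; rewrite orbT.
  move: E; rewrite scale0r addr0 sub0r mulrN mulrC => E.
  by rewrite -opprB E opprK.
Qed.

(** The axis-parallel paths from x to y run in this box; its corners x and y are
    not assumed to be ordered. *)
Definition box (R : realType) (n : nat) (x y : 'rV[R]_n) : set 'rV[R]_n :=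
  [set z | forall i, (x 0 i <= z 0 i <= y 0 i) || (y 0 i <= z 0 i <= x 0 i)].

Lemma box_ball (R : realType) (n : nat) (x y c : 'rV[R]_n) (e : R) :
  ball c e x -> ball c e y -> box x y `<=` ball c e.
Proof.
move=> [e0 cx] [_ cy] z bz; split=> // i j.
rewrite (ord1 i); move: (cx 0 j) (cy 0 j) (bz j); rewrite /ball /= !ltr_distl.
lra.
Qed.

Lemma box_norm (R : realType) (n : nat) (x y z : 'rV[R]_n) :
  box x y z -> `|z - x| <= `|y - x|.
Proof.
move=> bz; rewrite [leLHS]/Num.Def.normr [leRHS]/Num.Def.normr /= !mx_normrE.
apply: bigmax_le => [|[i j] _]; first by apply/bigmax_geP; left.
apply: (@le_trans _ _ `|(y - x) i j|); last exact: (le_bigmax _ _ (i, j)).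
rewrite (ord1 i) /= !mxE.
case/orP: (bz j) => /andP[xz zy]; first by rewrite !ger0_norm; lra.
by rewrite !ler0_norm; lra.
Qed.

(** Only partial derivatives are needed, because x can be joined to y by moving
    one coordinate at a time. *)
Lemma mean_value (R : realType) (n : nat) (f : 'rV[R]_n -> R) (x y : 'rV[R]_n) :
  (forall z, box x y z -> forall i, derivable f z (delta_mx 0 i)) ->
  exists2 xi : 'I_n -> 'rV[R]_n, (forall j, box x y (xi j)) &
    f y - f x = \sum_j (y 0 j - x 0 j) * 'D_(delta_mx 0 j) f (xi j).
Proof.
move=> df.
(* z k has the first k coordinates of y and the others of x *)
pose z (k : nat) : 'rV[R]_n := \row_i (if (i < k)%N then y 0 i else x 0 i).
have zS (k : 'I_n) : z k.+1 = z k + (y 0 k - x 0 k) *: delta_mx 0 k.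
  apply/rowP => i; rewrite !mxE ltnS leq_eqVlt !eqxx /=.
  case: (ltngtP i k) => [ik|ik|/val_inj ->] /=.
  - by rewrite (_ : (i == k) = false) ?mulr0 ?addr0//; apply/eqP => E; rewrite E ltnn in ik.
  - by rewrite (_ : (i == k) = false) ?mulr0 ?addr0//; apply/eqP => E; rewrite E ltnn in ik.
  - by rewrite eqxx mulr1 subrKC.
have step (k : 'I_n) : exists2 c, box x y c &
    f (z k.+1) - f (z k) = (y 0 k - x 0 k) * 'D_(delta_mx 0 k) f c.
  have inbox t : (0 <= t <= y 0 k - x 0 k) || (y 0 k - x 0 k <= t <= 0) ->
      box x y (z k + t *: delta_mx 0 k).
    move=> tb i; rewrite !mxE eqxx /=.
    have [->|ik] := eqVneq i k; first by rewrite ltnn mulr1; lra.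
    by rewrite mulr0 addr0; case: ifP; lra.
  have [t tb E] := @mean_value_line R _ f (z k) (delta_mx 0 k) (y 0 k - x 0 k)
     (fun t tb => df _ (inbox t tb) k).
  by exists (z k + t *: delta_mx 0 k); [exact: inbox|rewrite zS E].
have [xi xiP] := choice (fun k => let: ex_intro2 c b e := step k in
   ex_intro (fun c => box x y c /\ _) c (conj b e)).
exists xi; first by move=> j; have [] := xiP j.
have -> : f y - f x = f (z n) - f (z 0%N).
  by congr (f _ - f _); apply/rowP => i; rewrite mxE ?ltn_ord.
rewrite -(telescope_sumr (fun k => f (z k)) (leq0n n)) big_mkord.
by apply: eq_bigr => k _; have [_ ->] := xiP k.
Qed.

(** * Partial derivatives and composition *)

Lemma cvg_rV (R : realType) (n : nat) (T : Type) (F : set_system T)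
    {FF : Filter F} (f : T -> 'rV[R]_n) (l : 'rV[R]_n) :
  (forall j, f x 0 j @[x --> F] --> l 0 j) -> f x @[x --> F] --> l.
Proof.
move=> fl; apply/cvgrPdist_lt => e e0.
have : \forall x \near F, forall j, `|l 0 j - f x 0 j| < e.
  by apply: filter_forall => j; move/cvgrPdist_lt: (fl j) => /(_ e e0).
apply: filterS => x H.
rewrite [ltLHS]/Num.Def.normr /= mx_normrE; apply: bigmax_lt => // -[i j] _ /=.
by rewrite (ord1 i) !mxE.
Qed.

Lemma continuous_rV (R : realType) (n : nat) (T : topologicalType)
    (f : T -> 'rV[R]_n) (x : T) :
  (forall j, {for x, continuous (fun y => f y 0 j)}) -> {for x, continuous f}.
Proof. by move=> H; apply: cvg_rV => j; exact: H. Qed.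

Lemma is_derive_cvg (R : realType) (V : normedModType R) (f : V -> R)
    (x v : V) (l : R) :
  h^-1 * (f (h *: v + x) - f x) @[h --> 0^'] --> l -> is_derive x v f l.
Proof.
move=> fl; apply: DeriveDef; first exact: (cvgP _ fl).
exact: (cvg_lim _ fl).
Qed.

Lemma is_deriveP_cvg (R : realType) (V : normedModType R) (f : V -> R)
    (x v : V) (l : R) :
  is_derive x v f l -> h^-1 * (f (h *: v + x) - f x) @[h --> 0^'] --> l.
Proof. by case=> df <-. Qed.

Lemma derivable_continuous_line (R : realType) (V : normedModType R)
    (f : V -> R) (x v : V) :
  derivable f x v -> f (h *: v + x) @[h --> 0] --> f x.
Proof.
move=> /derivable1P /derivable1_diffP /differentiable_continuous.
by rewrite /prop_for /continuous_at /= scale0r add0r; apply.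
Qed.

Lemma cvg_sumr (R : realType) (T I : Type) (F : set_system T) {FF : Filter F}
    (r : seq I) (f : I -> T -> R) (l : I -> R) :
  (forall i, f i x @[x --> F] --> l i) ->
  \sum_(i <- r) f i x @[x --> F] --> \sum_(i <- r) l i.
Proof.
move=> fl; elim: r => [|i r IH].
  by rewrite big_nil; under eq_fun do rewrite big_nil; exact: cvg_cst.
rewrite big_cons; under eq_fun do rewrite big_cons.
exact: cvgD.
Qed.

(** Continuity of the partial derivatives of f replaces total
    differentiability: by the mean value theorem, the increments of f are
    exact linear combinations of the increments of the components of phi. *)
Lemma chain_rule (R : realType) (V : normedModType R) (l : nat)
    (f : 'rV[R]_l -> R) (phi : V -> 'rV[R]_l) (x v : V) (d : 'I_l -> R) :
  (\forall y \near phi x, forall j, derivable f y (delta_mx 0 j)) ->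
  (forall j, {for phi x, continuous ('D_(delta_mx 0 j) f)}) ->
  (forall j, is_derive x v (fun y => phi y 0 j) (d j)) ->
  is_derive x v (f \o phi) (\sum_j d j * 'D_(delta_mx 0 j) f (phi x)).
Proof.
move=> df cf dphi.
have [e /= e0 ef] := (nbhs_ballP _ _).1 df.
pose g (h : R) := phi (h *: v + x).
have g0 : g h @[h --> 0] --> phi x.
  apply: cvg_rV => j; case: (dphi j) => dj _.
  exact: (derivable_continuous_line dj).
have bx : ball (phi x) e (phi x) by exact: ballxx.
have /choice[xi xiP] : forall h, exists xi : 'I_l -> 'rV[R]_l,
    ball (phi x) e (g h) -> (forall j, box (phi x) (g h) (xi j)) /\
    f (g h) - f (phi x) =
      \sum_j (g h 0 j - phi x 0 j) * 'D_(delta_mx 0 j) f (xi j).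
  move=> h; have [gh|gh] := pselect (ball (phi x) e (g h)); last by exists (fun=> 0).
  have [|xi b E] := @mean_value R l f (phi x) (g h); last by exists xi.
  by move=> z /(box_ball bx gh) /ef.
have gd : g h @[h --> 0^'] --> phi x by exact: cvg_within_filter g0.
have gb : \forall h \near 0^', ball (phi x) e (g h).
  by apply: (gd (ball (phi x) e)); exact: nbhsx_ballx.
have xil j : xi h j @[h --> 0^'] --> phi x.
  apply/cvgrPdist_lt => r r0; near=> h.
  have [|b _] := xiP h; first by near: h.
  rewrite distrC (le_lt_trans (box_norm (b j)))// distrC.
  by near: h; move/cvgrPdist_lt: gd; apply.
apply: is_derive_cvg.
have : \sum_j (h^-1 * (g h 0 j - phi x 0 j)) * 'D_(delta_mx 0 j) f (xi h j)
    @[h --> 0^'] --> \sum_j d j * 'D_(delta_mx 0 j) f (phi x).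
  apply: cvg_sumr => j; apply: cvgM; first exact: is_deriveP_cvg (dphi j).
  exact: (@continuous_cvg _ _ _ _ _ (xi^~ j) ('D_(delta_mx 0 j) f) _ (cf j) (xil j)).
apply: cvg_trans; apply: near_eq_cvg.
near=> h; have [|_ E] := xiP h; first by near: h.
rewrite /= -/(g h) E mulr_sumr; apply: eq_bigr => j _; by rewrite mulrA.
Unshelve. all: by end_near. Qed.

(** * Smooth functions on open subsets of R^n *)

Section SmoothFunctions.
Variables (R : realType) (n : nat).
Implicit Types (V W : set 'rV[R]_n) (f g : 'rV[R]_n -> R) (k : nat).

Lemma open_near V (P : 'rV[R]_n -> Prop) (x : 'rV[R]_n) : open V -> V x ->
  (forall y, V y -> P y) -> \forall y \near x, P y.
Proof. by move=> oV Vx H; apply: filterS H _; exact: open_nbhs_nbhs. Qed.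

Lemma Ck_continuous k V f x : Ck k V f -> V x -> {for x, continuous f}.
Proof. by case: k => [|k] [cf _] Vx; exact: cf. Qed.

Lemma Ck_derivable k V f x i : Ck k.+1 V f -> V x ->
  derivable f x (delta_mx 0 i).
Proof. by move=> [_ df] Vx; have [+ _] := df i; exact. Qed.

Lemma Ck_derive k V f i : Ck k.+1 V f -> Ck k V ('D_(delta_mx 0 i) f).
Proof. by move=> [_ df]; have [_] := df i. Qed.

Lemma CkS k V f : Ck k.+1 V f -> Ck k V f.
Proof.
elim: k f => [|k IH] f [cf df]; first by split.
split=> // i; have [dfi Cfi] := df i; split=> //; exact: IH.
Qed.

(** Ck is a condition at each point of V separately, hence W need not be open. *)
Lemma Ck_local k V f : (forall x, V x -> exists2 W, W x & Ck k W f) -> Ck k V f.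
Proof.
elim: k f => [|k IH] f H.
  by split=> // x /H[W Wx /Ck_continuous]; exact.
split=> [x /H[W Wx /Ck_continuous]|i]; first exact.
split=> [x /H[W Wx /Ck_derivable]|]; first exact.
by apply: IH => x /H[W Wx /Ck_derive CW]; exists W.
Qed.

Lemma Ck_sub k V W f : W `<=` V -> Ck k V f -> Ck k W f.
Proof. by move=> WV CV; apply: Ck_local => x /WV Vx; exists V. Qed.

Lemma Ck_ext k V f g : open V -> (forall x, V x -> f x = g x) ->
  Ck k V f -> Ck k V g.
Proof.
move=> oV; elim: k f g => [|k IH] f g fg [cf df];
  have nfg x : V x -> \forall y \near x, f y = g y
    by move=> Vx; exact: (open_near oV Vx fg).
  split=> // x Vx; rewrite /prop_for /continuous_at -fg//.
  by apply: cvg_trans (cf x Vx); exact: near_eq_cvg (nfg x Vx).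
split=> [x Vx|i].
  rewrite /prop_for /continuous_at -fg//.
  by apply: cvg_trans (cf x Vx); exact: near_eq_cvg (nfg x Vx).
have [dfi Cfi] := df i; split=> [x Vx|].
  exact: (near_eq_derivable (nfg x Vx) (dfi x Vx)).
by apply: IH Cfi => x Vx; exact/near_eq_derive/nfg.
Qed.

(** Stated for any formula df for the partial derivatives, such as the one that
    a product or chain rule provides. *)
Lemma CkS_intro k V f (df : 'I_n -> 'rV[R]_n -> R) : open V ->
  (forall x, V x -> {for x, continuous f}) ->
  (forall i x, V x -> is_derive x (delta_mx 0 i) f (df i x)) ->
  (forall i, Ck k V (df i)) -> Ck k.+1 V f.
Proof.
move=> oV cf dfE Cdf; split=> // i; split=> [x /(dfE i)[]//|].
by apply: Ck_ext (Cdf i) => // x /(dfE i)[_ ->].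
Qed.

Lemma Ck_is_derive k V f x i : Ck k.+1 V f -> V x ->
  is_derive x (delta_mx 0 i) f ('D_(delta_mx 0 i) f x).
Proof. by move=> Cf Vx; apply: DeriveDef => //; exact: Ck_derivable Cf Vx. Qed.

Lemma Ck_cst k V (a : R) : open V -> Ck k V (fun=> a).
Proof.
move=> oV; elim: k a => [|k IH] a; first by split=> // x _; exact: cst_continuous.
apply: (@CkS_intro _ _ _ (fun _ _ => 0)) => //.
by move=> x _; exact: cst_continuous.
Qed.

Lemma is_derive_coord (i j : 'I_n) (x : 'rV[R]_n) :
  is_derive x (delta_mx 0 i) (fun y : 'rV[R]_n => y 0 j) (j == i)%:R.
Proof.
apply: is_derive_cvg; apply: cvg_near_cst; near=> h.
rewrite !mxE /= addrK mulrA mulVf ?mul1r//.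
by near: h; exact: nbhs_dnbhs_neq.
Unshelve. all: by end_near. Qed.

Lemma Ck_coord k V (j : 'I_n) : open V -> Ck k V (fun x => x 0 j).
Proof.
move=> oV; apply: (@CkS k); apply: (@CkS_intro _ _ _ (fun i _ => (j == i)%:R)) => //.
- by move=> x _; exact: coord_continuous.
- by move=> i x _; exact: is_derive_coord.
- by move=> i; exact: Ck_cst.
Qed.

Lemma CkD k V f g : open V -> Ck k V f -> Ck k V g -> Ck k V (fun x => f x + g x).
Proof.
move=> oV; elim: k f g => [|k IH] f g Cf Cg.
  split=> // x Vx; apply: continuousD; [exact: (Ck_continuous Cf Vx)|exact: (Ck_continuous Cg Vx)].
apply: (@CkS_intro _ _ _ (fun i x => 'D_(delta_mx 0 i) f x + 'D_(delta_mx 0 i) g x)) => //.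
- by move=> x Vx; apply: continuousD; [exact: (Ck_continuous Cf Vx)|exact: (Ck_continuous Cg Vx)].
- by move=> i x Vx; apply: is_deriveD; [exact: (Ck_is_derive _ Cf Vx)|exact: (Ck_is_derive _ Cg Vx)].
- by move=> i; apply: IH; exact: Ck_derive.
Qed.

Lemma CkM k V f g : open V -> Ck k V f -> Ck k V g -> Ck k V (fun x => f x * g x).
Proof.
move=> oV; elim: k f g => [|k IH] f g Cf Cg.
  split=> // x Vx; apply: continuousM; [exact: (Ck_continuous Cf Vx)|exact: (Ck_continuous Cg Vx)].
apply: (@CkS_intro _ _ _ (fun i x => f x * 'D_(delta_mx 0 i) g x +
   g x * 'D_(delta_mx 0 i) f x)) => //.
- by move=> x Vx; apply: continuousM; [exact: (Ck_continuous Cf Vx)|exact: (Ck_continuous Cg Vx)].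
- by move=> i x Vx; apply: is_deriveM; [exact: (Ck_is_derive _ Cf Vx)|exact: (Ck_is_derive _ Cg Vx)].
- by move=> i; apply: CkD => //; apply: IH; do ?[exact: CkS|exact: Ck_derive].
Qed.

Lemma CkZ k V (a : R) f : open V -> Ck k V f -> Ck k V (fun x => a * f x).
Proof. by move=> oV; apply: CkM => //; exact: Ck_cst. Qed.

Lemma CkV k V f : open V -> (forall x, V x -> f x != 0) ->
  Ck k V f -> Ck k V (fun x => (f x)^-1).
Proof.
move=> oV f0; elim: k => [|k IH] Cf.
  by split=> // x Vx; apply: continuousV; [exact: f0|exact: (Ck_continuous Cf Vx)].
have CV := IH (CkS Cf).
apply: (@CkS_intro _ _ _ (fun i x => -1 * ((f x)^-1 * (f x)^-1 * 'D_(delta_mx 0 i) f x))) => //.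
- by move=> x Vx; apply: continuousV; [exact: f0|exact: (Ck_continuous Cf Vx)].
- move=> i x Vx; have dfx : derivable f x (delta_mx 0 i) := Ck_derivable Cf Vx.
  apply: DeriveDef; first exact: derivableV (f0 _ Vx) dfx.
  by rewrite (deriveV (f0 _ Vx) dfx) mulN1r -expr2 exprVn; exact: mulNr.
- move=> i; apply: CkZ => //; apply: (CkM oV); first exact: CkM.
  exact: Ck_derive.
Qed.

Lemma Ck_sum k V (I : Type) (r : seq I) (P : pred I) (f : I -> 'rV[R]_n -> R) :
  open V -> (forall i, P i -> Ck k V (f i)) ->
  Ck k V (fun x => \sum_(i <- r | P i) f i x).
Proof.
move=> oV Cf; elim: r => [|i r IH].
  by under eq_fun do rewrite big_nil; exact: Ck_cst.
under eq_fun do rewrite big_cons.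
by case: (boolP (P i)) => // Pi; apply: CkD => //; exact: Cf.
Qed.

Lemma Ck_prod k V (I : Type) (r : seq I) (P : pred I) (f : I -> 'rV[R]_n -> R) :
  open V -> (forall i, P i -> Ck k V (f i)) ->
  Ck k V (fun x => \prod_(i <- r | P i) f i x).
Proof.
move=> oV Cf; elim: r => [|i r IH].
  by under eq_fun do rewrite big_nil; exact: Ck_cst.
under eq_fun do rewrite big_cons.
by case: (boolP (P i)) => // Pi; apply: CkM => //; exact: Cf.
Qed.

Lemma Ck_det k V (l : nat) (A : 'rV[R]_n -> 'M[R]_l) : open V ->
  (forall i j, Ck k V (fun x => A x i j)) -> Ck k V (fun x => \det (A x)).
Proof.
move=> oV CA; apply: Ck_sum => // s _; apply: CkZ => //.
by apply: Ck_prod => // i _; exact: CA.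
Qed.

(** Cramer's rule: the entries are cofactors divided by the determinant. *)
Lemma Ck_invmx k V (l : nat) (A : 'rV[R]_n -> 'M[R]_l) (i j : 'I_l) : open V ->
  (forall x, V x -> A x \in unitmx) ->
  (forall i j, Ck k V (fun x => A x i j)) -> Ck k V (fun x => invmx (A x) i j).
Proof.
move=> oV uA CA.
apply: (@Ck_ext _ _ (fun x => (\det (A x))^-1 *
    ((-1) ^+ (j + i) * \det (row' j (col' i (A x)))))) => //.
  by move=> x /uA uAx; rewrite /invmx uAx !mxE.
apply: CkM => //.
  apply: CkV => //; last exact: Ck_det.
  by move=> x /uA; rewrite unitmxE unitfE.
apply: CkZ => //; apply: Ck_det => // i' j'.
by under eq_fun do rewrite !mxE; exact: CA.
Qed.

End SmoothFunctions.

Lemma Ck_comp (R : realType) (n l k : nat) (V : set 'rV[R]_n) (W : set 'rV[R]_l)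
    (f : 'rV[R]_l -> R) (phi : 'rV[R]_n -> 'rV[R]_l) :
  open V -> open W -> (forall x, V x -> W (phi x)) -> Ck k W f ->
  (forall j, Ck k V (fun x => phi x 0 j)) -> Ck k V (f \o phi).
Proof.
move=> oV oW VW Cf Cphi.
have cphi k' : (forall j, Ck k' V (fun x => phi x 0 j)) ->
    forall x, V x -> {for x, continuous phi}.
  by move=> C x Vx; apply: continuous_rV => j; exact: (Ck_continuous (C j) Vx).
elim: k f Cf Cphi => [|k IH] f Cf Cphi.
  split=> // x Vx; apply: continuous_comp; first exact: (cphi _ Cphi).
  by apply: Ck_continuous Cf _; exact: VW.
apply: (@CkS_intro _ _ _ _ _ (fun i x => \sum_j
  'D_(delta_mx 0 i) (fun x => phi x 0 j) x * ('D_(delta_mx 0 j) f \o phi) x)) => //.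
- move=> x Vx; apply: continuous_comp; first exact: (cphi _ Cphi).
  by apply: Ck_continuous Cf _; exact: VW.
- move=> i x Vx; apply: chain_rule.
  + apply: (open_near oW); first exact: VW.
    by move=> y Wy j; exact: Ck_derivable Cf Wy.
  + by move=> j; apply: Ck_continuous (Ck_derive j Cf) _; exact: VW.
  + by move=> j; exact: Ck_is_derive _ (Cphi j) Vx.
- move=> i; apply: Ck_sum => // j _; apply: CkM => //; first exact: Ck_derive.
  by apply: IH => [|j']; [exact: Ck_derive|exact: CkS].
Qed.

(** * Symmetry of second derivatives *)

(** The mean value theorem along e_i, applied to the increment of f along e_j,
    and then along e_j, applied to the i-th partial derivative. *)
Lemma second_difference (R : realType) (n : nat) (V : set 'rV[R]_n)
    (f : 'rV[R]_n -> R) (x : 'rV[R]_n) (i j : 'I_n) (e h : R) :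
  Ck 2 V f -> ball x e `<=` V -> 0 < h -> h + h < e ->
  exists2 y, ball x (h + h + h) y &
    f (x + h *: delta_mx 0 i + h *: delta_mx 0 j) - f (x + h *: delta_mx 0 i)
    - (f (x + h *: delta_mx 0 j) - f x)
    = h * (h * 'D_(delta_mx 0 j) ('D_(delta_mx 0 i) f) y).
Proof.
move=> Cf xV h0 he.
have near_x (s t r : R) : 0 <= s <= h -> 0 <= t <= h -> h + h < r ->
    ball x r (x + s *: delta_mx 0 i + t *: delta_mx 0 j).
  move=> sh th hr; split; first lra.
  move=> a b; rewrite (ord1 a) /ball /= !mxE eqxx /= ltr_distl.
  by case: (b == i); case: (b == j); rewrite ?(mulr0n, mulr1n) ?(mulr0, mulr1); lra.
have hb (t : R) : (0 <= t <= h) || (h <= t <= 0) -> 0 <= t <= h by lra.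
have hh : 0 <= h <= h by lra.
have E0 (z : 'rV[R]_n) : z = z + 0 *: delta_mx 0 j by rewrite scale0r addr0.
pose F y := f (y + h *: delta_mx 0 j) - f y.
have dF t : 0 <= t <= h -> is_derive (x + t *: delta_mx 0 i) (delta_mx 0 i) F
   ('D_(delta_mx 0 i) f (x + t *: delta_mx 0 i + h *: delta_mx 0 j)
     - 'D_(delta_mx 0 i) f (x + t *: delta_mx 0 i)).
  move=> tb; apply: is_deriveB.
    apply: is_derive_cvg.
    have := is_deriveP_cvg (Ck_is_derive i Cf (xV _ (near_x _ _ _ tb hh he))).
    by apply: cvg_trans; apply: near_eq_cvg; apply: nearW => r /=; rewrite addrA.
  apply: (Ck_is_derive _ Cf); apply: xV.
  by rewrite [x + _]E0; apply: near_x => //; lra.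
have [|s /hb sb E] := @mean_value_line R _ F x (delta_mx 0 i) h.
  by move=> t /hb /dF [].
have [_ dFE] := dF s sb.
have [|t /hb tb E'] := @mean_value_line R _ ('D_(delta_mx 0 i) f)
   (x + s *: delta_mx 0 i) (delta_mx 0 j) h.
  move=> t /hb tb; apply: Ck_derivable (Ck_derive i Cf) _.
  by apply: xV; exact: near_x.
exists (x + s *: delta_mx 0 i + t *: delta_mx 0 j); first by apply: near_x => //; lra.
by rewrite -E' -dFE -E.
Qed.

(** The second difference of f is symmetric in i and j, and its quotient by h^2
    tends to each of the two mixed derivatives. *)
Lemma derive_comm (R : realType) (n : nat) (V : set 'rV[R]_n)
    (f : 'rV[R]_n -> R) (x : 'rV[R]_n) (i j : 'I_n) :
  open V -> Ck 2 V f -> V x ->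
  'D_(delta_mx 0 i) ('D_(delta_mx 0 j) f) x =
  'D_(delta_mx 0 j) ('D_(delta_mx 0 i) f) x.
Proof.
move=> oV Cf Vx.
set a := LHS; set b := RHS; apply/eqP; rewrite -subr_eq0 -normr_eq0.
apply: contraT => ab.
pose r := `|a - b| / 2.
have r0 : 0 < r by rewrite divr_gt0// lt0r ab normr_ge0.
have cont i' j' : {for x, continuous ('D_(delta_mx 0 i') ('D_(delta_mx 0 j') f))}.
  exact: (Ck_continuous (Ck_derive _ (Ck_derive _ Cf)) Vx).
have /nbhs_ballP[e /= e0 eP] : \forall y \near x, [/\ V y,
    `|a - 'D_(delta_mx 0 i) ('D_(delta_mx 0 j) f) y| < r &
    `|b - 'D_(delta_mx 0 j) ('D_(delta_mx 0 i) f) y| < r].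
  have h1 : \forall y \near x, `|a - 'D_(delta_mx 0 i) ('D_(delta_mx 0 j) f) y| < r.
    by move/cvgrPdist_lt: (cont i j); apply.
  have h2 : \forall y \near x, `|b - 'D_(delta_mx 0 j) ('D_(delta_mx 0 i) f) y| < r.
    by move/cvgrPdist_lt: (cont j i); apply.
  have h3 : \forall y \near x, V y by exact: (open_near oV).
  by apply: filterS (filterI h3 (filterI h1 h2)) => y [? []]; split.
pose h := e / 4.
have eV : ball x e `<=` V by move=> y /eP[].
have h0 : 0 < h by rewrite /h; lra.
have he : h + h < e by rewrite /h; lra.
have [y yb Ey] := @second_difference R n V f x i j e h Cf eV h0 he.
have [z zb Ez] := @second_difference R n V f x j i e h Cf eV h0 he.
have he3 : h + h + h <= e by rewrite /h; clear -e0; lra.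
have be : ball x (h + h + h) `<=` ball x e by exact: le_ball.
have [_ _ bP] := eP y (be _ yb); have [_ aP _] := eP z (be _ zb).
have Eyz : 'D_(delta_mx 0 j) ('D_(delta_mx 0 i) f) y =
           'D_(delta_mx 0 i) ('D_(delta_mx 0 j) f) z.
  have hn : h != 0 by rewrite gt_eqF.
  apply: (mulfI hn); apply: (mulfI hn).
  apply: etrans (esym Ey) (etrans _ Ez).
  by rewrite [x + _ + _]addrAC !opprD !opprK addrACA.
rewrite Eyz in bP; rewrite distrC in bP.
have := le_lt_trans (ler_distD _ a b) (ltrD aP bP).
by rewrite /r -splitr ltxx.
Qed.

Lemma continuous_dist (R : realType) (V W : normedModType R) (f : V -> W) (x : V) :
  (forall r, 0 < r -> \forall z \near x, `|f x - f z| < r) ->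
  {for x, continuous f}.
Proof. by move=> H; apply/cvgrPdist_lt => r r0; exact: H. Qed.

Lemma cvg_line (R : realType) (V : normedModType R) (v x : V) :
  h *: v + x @[h --> (0 : R)^'] --> x.
Proof.
pose g (h : R) := h *: v + x.
have g0 : g h @[h --> 0] --> g 0.
  by apply: cvgD; [exact: scalel_continuous|exact: cvg_cst].
have -> : nbhs x = nbhs (g 0) by rewrite /g scale0r add0r.
exact: cvg_within_filter g0.
Qed.

(** * The inverse function theorem *)

(** The structure that Banach's fixed point theorem requires. *)
HB.instance Definition _ (R : realType) (n : nat) :=
  Uniform_isComplete.Build 'rV[R]_n cauchy_cvg.

Lemma contraction_fixed_point (R : realType) (n : nat)
    (T : 'rV[R]_n -> 'rV[R]_n) (a : 'rV[R]_n) (r : R) :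
  0 < r ->
  (forall x, `|a - x| <= r -> `|a - T x| <= r) ->
  (forall x y, `|a - x| <= r -> `|a - y| <= r ->
     `|T x - T y| <= 2^-1 * `|x - y|) ->
  exists2 p, `|a - p| <= r & p = T p.
Proof.
move=> r0 TU Tc.
pose U : set 'rV[R]_n := closed_ball a r.
have UE : U = [set x | `|a - x| <= r] by rewrite /U closed_ballE.
have TU' : {homo T : x / U x >-> U x} by rewrite UE => x /TU.
have [|||p Up pT] := @banach_fixed_point R 'rV[R]_n U (mkfun_fun TU').
- have h2 : 0 <= 2^-1 :> R by rewrite invr_ge0.
  exists (NngNum h2); split=> /=; first by rewrite invf_lt1// ltr1n.
  have UP x : U x -> `|a - x| <= r by rewrite UE.
  by move=> [x y] [/UP ax /UP ay]; exact: Tc.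
- exact: closed_ball_closed.
- by exists a; rewrite UE /= subrr normr0 ltW.
- by exists p => //; rewrite UE in Up.
Qed.

Lemma mx_norm_entry (R : realType) (p q : nat) (A : 'M[R]_(p, q)) i j :
  `|A i j| <= `|A|.
Proof.
by rewrite [leRHS]/Num.Def.normr /= mx_normrE; exact: (le_bigmax _ _ (i, j)).
Qed.

Lemma mx_norm_le (R : realType) (p q : nat) (A : 'M[R]_(p, q)) (r : R) :
  0 <= r -> (forall i j, `|A i j| <= r) -> `|A| <= r.
Proof.
move=> r0 H; rewrite [leLHS]/Num.Def.normr /= mx_normrE.
by apply: bigmax_le => // -[i j] _; exact: H.
Qed.

Lemma mx_norm_mul (R : realType) (p q s : nat) (A : 'M[R]_(p, q)) (B : 'M[R]_(q, s)) :
  `|A *m B| <= q%:R * (`|A| * `|B|).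
Proof.
apply: mx_norm_le => [|i j]; first by rewrite !mulr_ge0.
rewrite mxE (le_trans (ler_norm_sum _ _ _))//.
rewrite -[X in X%:R](card_ord q) mulr_natl -sumr_const; apply: ler_sum => k _.
by rewrite normrM ler_pM ?mx_norm_entry.
Qed.

(** Jacobian matrices act on row vectors on the right. *)
Definition jacobian_rV (R : realType) (n l : nat) (phi : 'rV[R]_n -> 'rV[R]_l)
    (x : 'rV[R]_n) : 'M[R]_(n, l) :=
  \matrix_(i, j) 'D_(delta_mx 0 i) (fun y => phi y 0 j) x.

(** Increments of phi are exactly linear in y - x, with a matrix whose entries
    are partial derivatives at intermediate points, one for each entry. *)
Lemma increment_matrix (R : realType) (n l : nat) (phi : 'rV[R]_n -> 'rV[R]_l)
    (c : 'rV[R]_n) (e r : R) (N : 'M[R]_(n, l)) (x y : 'rV[R]_n) :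
  0 <= r ->
  (forall z, ball c e z -> forall i j,
     derivable (fun y => phi y 0 j) z (delta_mx 0 i) /\
     `|N i j - jacobian_rV phi z i j| <= r) ->
  ball c e x -> ball c e y ->
  exists2 A : 'M[R]_(n, l), phi y - phi x = (y - x) *m A & `|N - A| <= r.
Proof.
move=> r0 H bx b_y.
have /choice[xi xiP] j : exists xi : 'I_n -> 'rV[R]_n,
    (forall i, box x y (xi i)) /\
    phi y 0 j - phi x 0 j = \sum_i (y 0 i - x 0 i) *
      'D_(delta_mx 0 i) (fun y => phi y 0 j) (xi i).
  have [|xi b E] := @mean_value R n (fun y => phi y 0 j) x y; last by exists xi.
  by move=> z /(box_ball bx b_y) bz i; have [] := H z bz i j.
exists (\matrix_(i, j) 'D_(delta_mx 0 i) (fun y => phi y 0 j) (xi j i)).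
  apply/rowP => j; rewrite !mxE; have [_ ->] := xiP j.
  by apply: eq_bigr => i _; rewrite !mxE.
apply: mx_norm_le => // i j; rewrite !mxE.
have [b _] := xiP j.
by have [_] := H _ (box_ball bx b_y (b i)) i j; rewrite mxE.
Qed.

Section InverseFunction.
Variables (R : realType) (m : nat) (V : set 'rV[R]_m)
  (phi : 'rV[R]_m -> 'rV[R]_m) (a : 'rV[R]_m).
Hypothesis oV : open V.
Hypothesis Va : V a.
Hypothesis Cphi : forall j, Cinf V (fun x => phi x 0 j).
Hypothesis Ja : jacobian_rV phi a \in unitmx.

Let J := jacobian_rV phi.
Let K := invmx (J a).

Lemma jacobian_near (c : 'rV[R]_m) (r : R) : 0 < r -> V c ->
  exists2 e, 0 < e & ball c e `<=` V /\ forall z, ball c e z -> forall i j,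
     derivable (fun y => phi y 0 j) z (delta_mx 0 i) /\
     `|J c i j - J z i j| <= r.
Proof.
move=> r0 Vc.
have : \forall z \near c, V z /\ forall i j, `|J c i j - J z i j| < r.
  have nV : \forall z \near c, V z by apply: open_nbhs_nbhs; split.
  near=> z; split; first by near: z.
  near: z; apply: filter_forall => i; apply: filter_forall => j.
  have := Ck_continuous (Ck_derive i (Cphi j 1)) Vc.
  move/cvgrPdist_lt => /(_ _ r0); apply: filterS => z.
  by rewrite /J !mxE.
move=> /nbhs_ballP[e /= e0 eP]; exists e => //; split=> [z /eP[]//|z /eP[Vz H] i j].
split; last exact/ltW.
exact: Ck_derivable (Cphi j 1) Vz.
Unshelve. all: by end_near. Qed.

(* eta bounds the oscillation of the Jacobian matrix so that
   x - phi x *m K becomes a 1/2-contraction *)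
Let eta := (2 * (m%:R * (m%:R * `|K|) + 1))^-1.

Let eta_gt0 : 0 < eta.
Proof. by rewrite invr_gt0 mulr_gt0// ltr_wpDl// !mulr_ge0. Qed.

Let half_bound (v : 'rV[R]_m) (A : 'M[R]_m) : `|J a - A| <= eta ->
  `|v - v *m A *m K| <= 2^-1 * `|v|.
Proof.
move=> Ae.
have -> : v - v *m A *m K = v *m (J a - A) *m K.
  by rewrite mulmxBr mulmxBl -mulmxA -[v *m J a *m K]mulmxA mulmxV// mulmx1.
apply: le_trans (mx_norm_mul _ _) _.
have := mx_norm_mul v (J a - A).
have m0 : 0 <= m%:R :> R by [].
have H : m%:R * (m%:R * `|K|) * eta <= 2^-1.
  rewrite /eta; set c := m%:R * _.
  have c0 : 0 <= c by rewrite !mulr_ge0.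
  rewrite invfM mulrCA ler_piMr ?invr_ge0// ler_pdivrMr ?mul1r ?lerDl//.
  by rewrite ltr_wpDl.
move=> E; apply: (@le_trans _ _ (m%:R * (m%:R * (`|v| * eta) * `|K|))).
  rewrite ler_wpM2l// ler_wpM2r//; apply: le_trans E _.
  by rewrite ler_wpM2l// ler_wpM2l.
rewrite (_ : m%:R * _ = m%:R * (m%:R * `|K|) * eta * `|v|); last by ring.
by rewrite ler_wpM2r.
Qed.

(** For y near phi a, the map x |-> x + (y - phi x) K is a 1/2-contraction of a
    closed ball around a, and its fixed point solves phi x = y. The resulting
    inverse psi is Lipschitz, so its difference quotients converge by
    [increment_matrix]. Its partial derivatives are the entries of
    invmx (J (psi y)), hence of class C^k as soon as psi is. The image is a ball,
    so that slices of it by affine subspaces are connected. *)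
Theorem inverse_function : exists2 e : R, 0 < e &
  exists W psi, [/\ open W, W a /\ W `<=` V,
    forall x, W x -> ball (phi a) e (phi x) /\ psi (phi x) = x,
    forall y, ball (phi a) e y -> W (psi y) /\ phi (psi y) = y &
    forall j, Cinf (ball (phi a) e) (fun y => psi y 0 j)].
Proof.
have [d d0 [dV dP]] := jacobian_near eta_gt0 Va.
pose B := ball a d.
have oB : open B by exact: ball_open.
have Ba : B a by exact: ballxx.
have incr x y : B x -> B y ->
    exists2 A : 'M[R]_m, phi y - phi x = (y - x) *m A & `|J a - A| <= eta.
  by move=> Bx By; exact: (@increment_matrix _ _ _ phi a d eta _ x y (ltW eta_gt0) dP).
have contr x y : B x -> B y ->
    `|(y - x) - (phi y - phi x) *m K| <= 2^-1 * `|y - x|.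
  by move=> Bx By; have [A -> Ae] := incr x y Bx By; exact: half_bound.
have Junit x : B x -> J x \in unitmx.
  move=> Bx; have Jx : `|J a - J x| <= eta.
    by apply: mx_norm_le; [exact: ltW|move=> i j; rewrite !mxE; have [_] := dP x Bx i j; rewrite !mxE].
  rewrite -row_free_unit -kermx_eq0; apply/rowV0P => v /sub_kermxP vJ.
  have := half_bound v Jx; rewrite vJ mul0mx subr0 => H.
  apply/eqP; rewrite -normr_le0.
  by have := normr_ge0 v; lra.
(* the Lipschitz constant of the inverse *)
pose L := 2 * (m%:R * `|K|).
have L0 : 0 <= L by rewrite !mulr_ge0.
have lip x y : B x -> B y -> `|y - x| <= L * `|phi y - phi x|.
  move=> Bx By; have := contr x y Bx By.
  have := mx_norm_mul (phi y - phi x) K.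
  have := ler_distD ((phi y - phi x) *m K) (y - x) 0; rewrite !subr0 /L.
  set u := `|y - x|; set v := `|_ *m K|; set w := `|phi y - phi x|.
  rewrite (_ : m%:R * (w * `|K|) = m%:R * `|K| * w); last by ring.
  rewrite -[2 * _ * w]mulrA; set z := _ * w; lra.
pose e := d / (8 * (m%:R * `|K| + 1)).
have K1 : 0 < m%:R * `|K| + 1 by rewrite ltr_wpDl// mulr_ge0.
have e0 : 0 < e by rewrite divr_gt0// mulr_gt0.
have mKe : m%:R * `|K| * e <= d / 8.
  rewrite /e; move: K1; set c := m%:R * _ => K1.
  have -> : c * (d / (8 * (c + 1))) = d / 8 * (c / (c + 1)).
    by rewrite invfM mulrA [LHS]mulrCA; rewrite !mulrA; ring.
  rewrite ler_piMr//; first by rewrite divr_ge0// ltW.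
  by rewrite ler_pdivrMr// mul1r lerDl.
have surj y : ball (phi a) e y -> exists x, ball a (d / 2) x /\ phi x = y.
  move=> yb; pose T x := x + (y - phi x) *m K.
  have d2 : 0 < d / 2 by lra.
  have UB x : `|a - x| <= d / 2 -> B x.
    by move=> H; rewrite /B -ball_normE /=; lra.
  have TT x z : B x -> B z -> `|T x - T z| <= 2^-1 * `|x - z|.
    move=> Bx Bz; rewrite (_ : T x - T z = (x - z) - (phi x - phi z) *m K); first exact: contr.
    
    by rewrite /T !mulmxBl opprD addrACA opprB [X in _ + X = _]addrC subrKA opprB.
  have Ta : `|T a - a| <= d / 8.
    rewrite /T addrC addKr; apply: le_trans (mx_norm_mul _ _) _.
    apply: le_trans mKe; rewrite mulrCA mulrC ler_wpM2l ?mulr_ge0//.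
    by move: yb; rewrite -ball_normE /= distrC => /ltW.
  have TU x : `|a - x| <= d / 2 -> `|a - T x| < d / 2.
    move=> ax; have := TT x a (UB x ax) Ba.
    have := ler_distD (T a) a (T x); rewrite (distrC a (T a)) (distrC (T a) (T x)).
    rewrite (distrC x a); lra.
  have [||p pU pT] := @contraction_fixed_point R m T a (d / 2) d2.
  - by move=> x /TU /ltW.
  - by move=> x z /UB Bx /UB Bz; exact: TT.
  exists p; split; first by rewrite -ball_normE /= {1}pT; exact: TU.
  have : (y - phi p) *m K = 0.
    by move/eqP: pT; rewrite /T -subr_eq0 opprD addrA subrr add0r oppr_eq0 => /eqP.
  move/(congr1 (mulmx^~ (J a))); rewrite mul0mx -mulmxA mulVmx// mulmx1 => /eqP.
  by rewrite subr_eq0 => /eqP.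
have /choice[psi psiP] y : exists x, ball (phi a) e y -> ball a (d / 2) x /\ phi x = y.
  have [/surj[x]|nb] := pselect (ball (phi a) e y); last by exists a.
  by exists x.
have d2B : ball a (d / 2) `<=` B by apply: le_ball; lra.
have inj x y : B x -> B y -> phi x = phi y -> x = y.
  move=> Bx By E; apply/esym/eqP; rewrite -subr_eq0 -normr_le0.
  by apply: le_trans (lip x y Bx By) _; rewrite E subrr normr0 mulr0.
have cphi x : V x -> {for x, continuous phi}.
  by move=> Vx; apply: continuous_rV => j; exact: Ck_continuous (Cphi j 0) Vx.
pose W := [set x | ball a (d / 2) x /\ ball (phi a) e (phi x)].
have psiW y : ball (phi a) e y -> W (psi y) /\ phi (psi y) = y.
  by move=> yb; have [b E] := psiP y yb; rewrite /W /= E.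
have psiB y : ball (phi a) e y -> B (psi y).
  by move=> yb; have [b _] := psiP y yb; exact: d2B.
have psilip y z : ball (phi a) e y -> ball (phi a) e z ->
    `|psi z - psi y| <= L * `|z - y|.
  move=> yb zb; have := lip (psi y) (psi z) (psiB _ yb) (psiB _ zb).
  by have [_ ->] := psiW y yb; have [_ ->] := psiW z zb.
have cpsi y : ball (phi a) e y -> {for y, continuous psi}.
  move=> yb; apply: continuous_dist => r r0.
  have L1 : 0 < L + 1 by rewrite ltr_wpDl.
  have n1 : \forall z \near y, ball (phi a) e z.
    by apply: open_nbhs_nbhs; split; [exact: ball_open|].
  have n2 : \forall z \near y, `|y - z| < r / (L + 1).
    by have := nbhsx_ballx y _ (divr_gt0 r0 L1); rewrite -ball_normE.
  apply: filterS (filterI n1 n2) => z [zb yz].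
  apply: le_lt_trans (psilip z y zb yb) _.
  move: yz; rewrite ltr_pdivlMr// => H; apply: le_lt_trans H.
  by rewrite mulrC ler_wpM2l// lerDl.
have dpsi y i j : ball (phi a) e y ->
    is_derive y (delta_mx 0 i) (fun y => psi y 0 j) (invmx (J (psi y)) i j).
  move=> yb; apply: is_derive_cvg.
  pose x := psi y; have Bx : B x := psiB y yb; have uJ := Junit x Bx.
  have Vx : V x by exact: dV.
  pose w (h : R) := h^-1 *: (psi (h *: delta_mx 0 i + y) - x).
  pose KK := invmx (J x).
  suff : w h @[h --> 0^'] --> row i KK.
    move=> wl; have : w h 0 j @[h --> 0^'] --> row i KK 0 j.
      exact: (@continuous_cvg _ _ _ _ _ w (fun z : 'rV[R]_m => z 0 j) _
        (@coord_continuous _ _ _ 0 j _) wl).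
    rewrite [row i KK 0 j]mxE; apply: cvg_trans.
    by apply: near_eq_cvg; apply: nearW => h; rewrite /w /= !mxE.
  apply/cvgrPdist_lt => r r0.
  (* w h = e_i KK - w h (A - J x) KK with |w h| <= L |e_i| *)
  pose c := m%:R * (m%:R * (L * `|delta_mx 0 i : 'rV[R]_m|) * `|KK|).
  have c0 : 0 <= c by rewrite !mulr_ge0.
  have c1 : 0 < c + 1 by rewrite ltr_wpDl.
  have rc : 0 < r / (c + 1) by exact: divr_gt0.
  have [s s0 [sV sP]] := jacobian_near rc Vx.
  have line : (h *: delta_mx 0 i + y) @[h --> 0^'] --> y.
    exact: cvg_line.
  near=> h.
  have h0 : h != 0 by near: h; exact: nbhs_dnbhs_neq.
  have hb : ball (phi a) e (h *: delta_mx 0 i + y).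
    near: h; apply: (line (ball (phi a) e)); apply: open_nbhs_nbhs; split=> //; exact: ball_open.
  have hs : ball x s (psi (h *: delta_mx 0 i + y)).
    near: h; apply: (line (fun z => ball x s (psi z))).
    by apply: (cpsi y yb); exact: nbhsx_ballx.
  have [A AE Ar] := @increment_matrix _ _ _ phi x s (r / (c + 1)) _ x _ (ltW rc) sP (ballxx _ s0) hs.
  have [_ E1] := psiW y yb; have [_ E2] := psiW _ hb.
  have wA : w h *m A = delta_mx 0 i.
    by rewrite /w -scalemxAl -AE E2 E1 addrK scalerA mulVf ?scale1r.
  have -> : row i KK - w h = w h *m (A - J x) *m KK.
    rewrite mulmxBr mulmxBl wA -rowE -mulmxA mulmxV// ?mulmx1//.
  have wL : `|w h| <= L * `|delta_mx 0 i : 'rV[R]_m|.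
    rewrite /w normrZ normfV ler_pdivrMl ?normr_gt0//.
    apply: le_trans (psilip y _ yb hb) _.
    by rewrite addrK normrZ mulrCA.
  apply: (@le_lt_trans _ _ (c * (r / (c + 1)))).
    apply: le_trans (mx_norm_mul _ _) _.
    set Le := L * _ in c c0 c1 rc sP Ar wL *.
    rewrite (_ : c * _ = m%:R * (m%:R * (Le * (r / (c + 1))) * `|KK|)); last first.
      by rewrite {1}/c; ring.
    rewrite ler_wpM2l// ler_wpM2r//; apply: le_trans (mx_norm_mul _ _) _.
    by rewrite ler_wpM2l// ler_pM// distrC.
  rewrite mulrA ltr_pdivrMr// mulrC ltr_pM2l//.
  by rewrite ltrDl.
exists e => //; exists W, psi; split.
- rewrite openE => x [xd xe]; rewrite /interior.
  apply: (@filterI _ (nbhs x) _ (ball a (d / 2)) (phi @^-1` ball (phi a) e)).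
    by apply: open_nbhs_nbhs; split=> //; apply: ball_open; lra.
  apply: (cphi x (dV _ (d2B _ xd))); apply: open_nbhs_nbhs; split=> //.
  exact: ball_open.
- split; first by split; apply: ballxx; lra.
  by move=> x [/d2B /dV].
- move=> x [xd xe]; split=> //; apply: inj; first exact: psiB.
    exact: d2B.
  by have [] := psiW _ xe.
- exact: psiW.
move=> j k; elim: k j => [|k IH] j.
  split=> // y yb; apply: (@continuous_comp _ _ _ psi (fun z : 'rV[R]_m => z 0 j)).
    exact: cpsi.
  exact: coord_continuous.
have cpsij y : ball (phi a) e y -> {for y, continuous (fun y => psi y 0 j)}.
  move=> yb; apply: (@continuous_comp _ _ _ psi (fun z : 'rV[R]_m => z 0 j)).
    exact: cpsi.
  exact: coord_continuous.
have oBe : open (ball (phi a) e) by exact: ball_open.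
refine (@CkS_intro R m k (ball (phi a) e) (fun y => psi y 0 j)
  (fun i y => invmx (J (psi y)) i j) oBe cpsij
  (fun i y yb => dpsi y i j yb) _) => i.
apply: (@Ck_comp _ _ _ k (ball (phi a) e) B (fun x => invmx (J x) i j) psi) => //.
apply: Ck_invmx => // i' j'.
apply: (Ck_sub dV).
by under eq_fun do rewrite mxE; exact: Ck_derive (Cphi _ _).
Unshelve. all: by end_near. Qed.

End InverseFunction.

(** * Smooth functions on a manifold *)

Section Charts.
Variables (R : realType) (T : topologicalType) (n : nat).
Implicit Types (c : chart R T n) (U : set T).

Lemma chart_imageP c U z : is_chart c -> (cmap c @` (cdom c `&` U)) z ->
  [/\ cdom c (cinv c z), U (cinv c z) & cmap c (cinv c z) = z].
Proof. by move=> [_ _ cK _ _] [x [cx Ux] <-]; rewrite cK. Qed.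

Lemma chart_image_open c U : is_chart c -> open U ->
  open (cmap c @` (cdom c `&` U)).
Proof.
move=> cc oU; have [oc oi cK ccont icont] := cc.
rewrite openE => _ [x [cx Ux] <-]; rewrite /interior.
have nx : nbhs (cinv c (cmap c x)) (cdom c `&` U).
  by rewrite cK//; apply: open_nbhs_nbhs; split=> //; exact: openI.
have n1 : nbhs (cmap c x) (cinv c @^-1` (cdom c `&` U)) by exact: icont nx.
have n2 : nbhs (cmap c x) (cmap c @` cdom c).
  by apply: open_nbhs_nbhs; split=> //; exists x.
apply: filterS (filterI n1 n2) => z [zU [y cy yz]].
by exists y => //; move: zU; rewrite /= -yz cK.
Qed.

(** In the chart c, f is its expression in c' after the change of coordinates. *)
Lemma chart_transport c c' U (f : T -> R) : is_chart c -> is_chart c' ->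
  smooth_transition c c' -> open U -> U `<=` cdom c `&` cdom c' ->
  Cinf (cmap c' @` U) (f \o cinv c') -> Cinf (cmap c @` U) (f \o cinv c).
Proof.
move=> cc cc' tr oU Ucc' Cf k.
have UE (d : chart R T n) : U `<=` cdom d -> cdom d `&` U = U
  by move=> Ud; apply/setIidr.
have Uc : U `<=` cdom c by move=> x /Ucc'[].
have Uc' : U `<=` cdom c' by move=> x /Ucc'[].
have oc : open (cmap c @` U) by rewrite -(UE _ Uc); exact: chart_image_open.
have oc' : open (cmap c' @` U) by rewrite -(UE _ Uc'); exact: chart_image_open.
have [_ _ cK _ _] := cc; have [_ _ cK' _ _] := cc'.
apply: (@Ck_ext _ _ _ _ ((f \o cinv c') \o (cmap c' \o cinv c))) => //.
  by move=> _ [x Ux <-] /=; rewrite cK ?cK'//; [exact: Uc'|exact: Uc].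
apply: (@Ck_comp _ _ _ _ _ (cmap c' @` U)) => //.
  by move=> _ [x Ux <-] /=; rewrite cK; [exists x|exact: Uc].
move=> j; apply: Ck_sub (tr j k) => _ [x Ux <-].
by exists x => //; exact: Ucc'.
Qed.

End Charts.

Section Smooth.
Variables (R : realType) (m : nat) (M : manifold R m).
Implicit Types (p x : M) (U W : set M) (f g : M -> R) (c : chart R M m).

Lemma compatible_chart_at p : compatible_chart (chart_at p).
Proof.
by split=> [|r]; [exact: chart_atP|split; exact: chart_at_smooth].
Qed.

Lemma compatible_open c : compatible_chart c -> open (cdom c).
Proof. by case=> -[]. Qed.

Lemma smooth_sub U W f : W `<=` U -> smooth U f -> smooth W f.
Proof.
move=> WU Cf p k; apply: Ck_sub (Cf p k) => _ [x [cx Wx] <-].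
by exists x => //; split=> //; exact: WU.
Qed.

Lemma smooth_ext U f g : open U -> (forall x, U x -> f x = g x) ->
  smooth U f -> smooth U g.
Proof.
move=> oU fg Cf p k; apply: Ck_ext (Cf p k).
  by apply: chart_image_open => //; exact: chart_atP.
by move=> z /(chart_imageP (chart_atP p))[_ Uz _] /=; exact: fg.
Qed.

Lemma smooth_local U f : (forall x, U x -> exists2 W, W x & smooth W f) ->
  smooth U f.
Proof.
move=> H p k; apply: Ck_local => _ [x [cx Ux] <-].
have [W Wx Cf] := H x Ux; exists (cmap (chart_at p) @` (cdom (chart_at p) `&` W)).
  by exists x.
exact: Cf.
Qed.

Lemma smooth_chart c U f : compatible_chart c -> open U -> smooth U f ->
  Cinf (cmap c @` (cdom c `&` U)) (f \o cinv c).
Proof.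
move=> [cc ctr] oU Cf k; apply: Ck_local => _ [x [cx Ux] <-].
pose O := cdom c `&` U `&` cdom (chart_at x).
have oO : open O.
  by apply: openI; [apply: openI => //; case: cc|case: (chart_atP x)].
exists (cmap c @` O); first by exists x => //; split=> //; exact: mem_chart_at.
have [_ tr] := ctr x.
apply: (chart_transport cc (chart_atP x) tr oO); first by move=> y [[]].
move=> k'; apply: Ck_sub (Cf x k') => _ [y [[cy Uy] cxy] <-].
by exists y.
Qed.

Lemma chart_smooth c U f : compatible_chart c -> open U -> U `<=` cdom c ->
  Cinf (cmap c @` U) (f \o cinv c) -> smooth U f.
Proof.
move=> [cc ctr] oU Uc Cf p; have [tr _] := ctr p.
apply: (chart_transport (chart_atP p) cc tr).
- by apply: openI => //; case: (chart_atP p).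
- by move=> x [px Ux]; split=> //; exact: Uc.
- by move=> k; apply: Ck_sub (Cf k) => _ [x [_ Ux] <-]; exists x.
Qed.

Lemma smooth_ccoord c i : compatible_chart c -> smooth (cdom c) (ccoord c i).
Proof. by move=> [cc ctr] p; have [tr _] := ctr p; exact: tr. Qed.

Lemma smooth_continuous U f x : open U -> smooth U f -> U x ->
  {for x, continuous f}.
Proof.
move=> oU Cf Ux; have [ox _ xK xcont _] := chart_atP x.
have cx := mem_chart_at x.
have cf : {for cmap (chart_at x) x, continuous (f \o cinv (chart_at x))}.
  by apply: Ck_continuous (Cf x 0) _; exists x.
have := continuous_comp (xcont x cx) cf.
rewrite /prop_for /continuous_at /= xK//; apply: cvg_trans.
apply: near_eq_cvg; apply: filterS (open_nbhs_nbhs (conj ox cx)) => y cy /=.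
by rewrite xK.
Qed.

Lemma smooth_cst U (a : R) : open U -> smooth U (fun=> a).
Proof.
by move=> oU p k; apply: Ck_cst; exact: chart_image_open (chart_atP p) oU.
Qed.

Lemma smoothD U f g : open U -> smooth U f -> smooth U g ->
  smooth U (fun x => f x + g x).
Proof.
by move=> oU Cf Cg p k; apply: CkD (Cf p k) (Cg p k); exact: chart_image_open (chart_atP p) oU.
Qed.

Lemma smoothM U f g : open U -> smooth U f -> smooth U g ->
  smooth U (fun x => f x * g x).
Proof.
by move=> oU Cf Cg p k; apply: CkM (Cf p k) (Cg p k); exact: chart_image_open (chart_atP p) oU.
Qed.

Lemma smoothZ U (a : R) f : open U -> smooth U f -> smooth U (fun x => a * f x).
Proof. by move=> oU; apply: smoothM => //; exact: smooth_cst. Qed.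

Lemma smoothN U f : open U -> smooth U f -> smooth U (fun x => - f x).
Proof.
by move=> oU Cf; apply: smooth_ext (smoothZ (-1) oU Cf) => // x _; rewrite mulN1r.
Qed.

Lemma smoothB U f g : open U -> smooth U f -> smooth U g ->
  smooth U (fun x => f x - g x).
Proof. by move=> oU Cf Cg; apply: smoothD => //; exact: smoothN. Qed.

Lemma smooth_sum U (I : Type) (r : seq I) (P : pred I) (f : I -> M -> R) :
  open U -> (forall i, P i -> smooth U (f i)) ->
  smooth U (fun x => \sum_(i <- r | P i) f i x).
Proof.
move=> oU Cf p k; apply: (@Ck_sum _ _ _ _ _ _ _ (fun i => f i \o cinv (chart_at p))).
  exact: chart_image_open (chart_atP p) oU.
by move=> i Pi; exact: Cf.
Qed.

Lemma smooth_det U (l : nat) (A : M -> 'M[R]_l) : open U ->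
  (forall i j, smooth U (fun x => A x i j)) -> smooth U (fun x => \det (A x)).
Proof.
move=> oU CA p k; apply: (@Ck_det _ _ _ _ _ (fun z => A (cinv (chart_at p) z))).
  exact: chart_image_open (chart_atP p) oU.
by move=> i j; exact: CA.
Qed.

Lemma smooth_invmx U (l : nat) (A : M -> 'M[R]_l) (i j : 'I_l) : open U ->
  (forall x, U x -> A x \in unitmx) ->
  (forall i j, smooth U (fun x => A x i j)) -> smooth U (fun x => invmx (A x) i j).
Proof.
move=> oU uA CA p k; apply: (@Ck_invmx _ _ _ _ _ (fun z => A (cinv (chart_at p) z))).
- exact: chart_image_open (chart_atP p) oU.
- by move=> z /(chart_imageP (chart_atP p))[_ Uz _]; exact: uA.
- by move=> i' j'; exact: CA.
Qed.

Lemma smooth_comp U (l : nat) (W : set 'rV[R]_l) (F : 'rV[R]_l -> R)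
    (u : M -> 'rV[R]_l) : open U -> open W -> (forall x, U x -> W (u x)) ->
  Cinf W F -> (forall j, smooth U (fun x => u x 0 j)) -> smooth U (F \o u).
Proof.
move=> oU oW UW CF Cu p k.
apply: (@Ck_comp _ _ _ _ _ W F (u \o cinv (chart_at p))) => //.
- exact: chart_image_open (chart_atP p) oU.
- by move=> z /(chart_imageP (chart_atP p))[_ Uz _]; exact: UW.
- by move=> j; exact: Cu.
Qed.

Lemma smooth_preimage_open (U : set M) (l : nat) (u : M -> 'rV[R]_l) (W : set 'rV[R]_l) :
  open U -> open W -> (forall j, smooth U (fun x => u x 0 j)) ->
  open (U `&` u @^-1` W).
Proof.
move=> oU oW Cu; rewrite openE => x [Ux Wx]; rewrite /interior.
have cu : {for x, continuous u}.
  by apply: continuous_rV => j; exact: smooth_continuous oU (Cu j) Ux.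
have n1 : nbhs x U by exact: open_nbhs_nbhs.
have n2 : nbhs x (u @^-1` W) by apply: cu; exact: open_nbhs_nbhs.
exact: filterI n1 n2.
Qed.

Lemma smooth_unit_open (U : set M) (l : nat) (Z : M -> 'M[R]_l) :
  open U -> (forall i j, smooth U (fun x => Z x i j)) ->
  open (U `&` [set x | Z x \in unitmx]).
Proof.
move=> oU CZ.
have -> : U `&` [set x | Z x \in unitmx] =
   U `&` (fun x => \row_(j < 1) \det (Z x)) @^-1` [set y : 'rV[R]_1 | y 0 0 != 0].
  by apply/seteqP; split=> x [Ux]; rewrite /= mxE unitmxE unitfE.
apply: smooth_preimage_open => //.
  rewrite (_ : mkset _ = (fun y : 'rV[R]_1 => y 0 0) @^-1` [set t | t != 0])//.
  apply: open_comp; last exact: open_neq.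
  by move=> y _; exact: coord_continuous.
by move=> j; under eq_fun do rewrite mxE; exact: smooth_det.
Qed.

Lemma smooth_mulmx (U : set M) (a b c : nat) (A : M -> 'M[R]_(a, b))
    (B : M -> 'M[R]_(b, c)) : open U ->
  (forall i j, smooth U (fun x => A x i j)) ->
  (forall i j, smooth U (fun x => B x i j)) ->
  forall i j, smooth U (fun x => (A x *m B x) i j).
Proof.
move=> oU CA CB i j; under eq_fun do rewrite mxE.
by apply: (@smooth_sum _ _ _ _ (fun k x => A x i k * B x k j)) => // k _; exact: smoothM.
Qed.

(** * Differentials *)

Lemma near_chart U p : open U -> U p ->
  \forall z \near cmap (chart_at p) p, U (cinv (chart_at p) z).
Proof.
move=> oU Up; have [_ _ pK _ icont] := chart_atP p.
have cp := mem_chart_at p.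
apply: (icont p cp); rewrite pK//; exact: open_nbhs_nbhs.
Qed.

Lemma differential_near U f g p : open U -> U p ->
  (forall x, U x -> f x = g x) -> differential f p = differential g p.
Proof.
move=> oU Up fg; apply/rowP => i; rewrite !mxE; apply: near_eq_derive.
by apply: filterS (near_chart oU Up) => z Uz /=; exact: fg.
Qed.

Lemma smooth_is_derive U f p i : smooth U f -> U p ->
  is_derive (cmap (chart_at p) p) (delta_mx 0 i) (f \o cinv (chart_at p))
    (differential f p 0 i).
Proof.
move=> Cf Up; rewrite mxE; apply: (Ck_is_derive _ (Cf p 1)).
by exists p => //; split=> //; exact: mem_chart_at.
Qed.

Lemma differential_cst (a : R) p : differential (fun=> a : R) p = 0 :> 'rV[R]_m.
Proof. by apply/rowP => i; rewrite !mxE; exact: derive_cst. Qed.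

Lemma cinv_cmap p : cinv (chart_at p) (cmap (chart_at p) p) = p.
Proof. by have [_ _ pK _ _] := chart_atP p; rewrite pK//; exact: mem_chart_at. Qed.

Lemma differential_comp U (l : nat) (W : set 'rV[R]_l) (F : 'rV[R]_l -> R)
    (u : M -> 'rV[R]_l) p : U p -> open W -> W (u p) ->
  Cinf W F -> (forall j, smooth U (fun x => u x 0 j)) ->
  differential (F \o u) p =
    \sum_j 'D_(delta_mx 0 j) F (u p) *: differential (fun x => u x 0 j) p.
Proof.
move=> Up oW Wu CF Cu; apply/rowP => i; rewrite mxE summxE.
have uE : (u \o cinv (chart_at p)) (cmap (chart_at p) p) = u p.
  by rewrite /= cinv_cmap.
have [_ ->] : is_derive (cmap (chart_at p) p) (delta_mx 0 i)
    (F \o (u \o cinv (chart_at p)))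
    (\sum_j differential (fun x => u x 0 j) p 0 i *
       'D_(delta_mx 0 j) F ((u \o cinv (chart_at p)) (cmap (chart_at p) p))).
  apply: chain_rule; rewrite ?uE.
  - by apply: (open_near oW Wu) => y Wy j; exact: Ck_derivable (CF 1) Wy.
  - by move=> j; exact: Ck_continuous (Ck_derive j (CF 1)) Wu.
  - by move=> j; exact: smooth_is_derive (Cu j) Up.
by apply: eq_bigr => j _; rewrite uE [RHS]mxE mulrC.
Qed.

Lemma differentialD U f g p : U p -> smooth U f -> smooth U g ->
  differential (fun x => f x + g x) p = differential f p + differential g p.
Proof.
move=> Up Cf Cg; apply/rowP => i; rewrite mxE [RHS]mxE.
have df := smooth_is_derive i Cf Up; have dg := smooth_is_derive i Cg Up.
by have [_] := is_deriveD df dg.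
Qed.

Lemma differentialM U f g p : U p -> smooth U f -> smooth U g ->
  differential (fun x => f x * g x) p =
  f p *: differential g p + g p *: differential f p.
Proof.
move=> Up Cf Cg; apply/rowP => i; rewrite mxE [RHS]mxE.
have df := smooth_is_derive i Cf Up; have dg := smooth_is_derive i Cg Up.
have [_] := is_deriveM df dg; rewrite /= cinv_cmap => E.
by rewrite [X in X + _]mxE [X in _ + X]mxE; exact: E.
Qed.

Lemma differentialZ U (a : R) f p : U p -> smooth U f ->
  differential (fun x => a * f x) p = a *: differential f p.
Proof.
move=> Up Cf; apply/rowP => i; rewrite mxE [RHS]mxE.
have df := smooth_is_derive i Cf Up.
by have [_] := is_deriveZ a df.
Qed.

Lemma differentialN U f p : U p -> smooth U f ->
  differential (fun x => - f x) p = - differential f p.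
Proof.
move=> Up Cf; rewrite -scaleN1r -(differentialZ _ Up Cf).
by congr differential; apply/funext => x; rewrite mulN1r.
Qed.

Lemma differentialB U f g p : open U -> U p -> smooth U f -> smooth U g ->
  differential (fun x => f x - g x) p = differential f p - differential g p.
Proof.
move=> oU Up Cf Cg.
by rewrite (differentialD Up Cf (smoothN oU Cg)) (differentialN Up Cg).
Qed.

Lemma differential_sum U (I : Type) (r : seq I) (f : I -> M -> R) p :
  open U -> U p -> (forall i, smooth U (f i)) ->
  differential (fun x => \sum_(i <- r) f i x) p = \sum_(i <- r) differential (f i) p.
Proof.
move=> oU Up Cf; elim: r => [|i r IH].
  by rewrite big_nil -[RHS](differential_cst 0 p); congr differential;
     apply/funext => x; rewrite big_nil.
rewrite big_cons -IH -(differentialD Up (Cf i)); last exact: smooth_sum.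
by congr differential; apply/funext => x; rewrite big_cons.
Qed.

Lemma differential_mcoord p i : differential (mcoord p i) p = delta_mx 0 i.
Proof.
have [_ _ pK _ _] := chart_atP p; have op := compatible_open (compatible_chart_at p).
have cp := mem_chart_at p.
apply/rowP => j; rewrite !mxE /=.
have [_ E] := is_derive_coord j i (cmap (chart_at p) p).
rewrite [LHS](@near_eq_derive _ _ _ _ (fun z : 'rV[R]_m => z 0 i)) ?E 1?eq_sym//.
have [_ oi _ _ _] := chart_atP p.
apply: filterS (open_nbhs_nbhs (conj oi (ex_intro2 _ _ p cp erefl))).
by move=> _ [x cx <-]; rewrite /mcoord /ccoord /= pK.
Qed.

Definition chart_partial c (i : 'I_m) f : M -> R :=
  fun x => 'D_(delta_mx 0 i) (f \o cinv c) (cmap c x).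

Lemma smooth_chart_partial c i U f : compatible_chart c -> open U -> U `<=` cdom c ->
  smooth U f -> smooth U (chart_partial c i f).
Proof.
move=> cc oU Uc Cf; have [[_ _ cK _ _] _] := cc.
have UE : cdom c `&` U = U by apply/setIidr.
have oi : open (cmap c @` U) by rewrite -UE; apply: chart_image_open => //; case: cc.
apply: (chart_smooth cc oU Uc) => k.
apply: (@Ck_ext _ _ _ _ ('D_(delta_mx 0 i) (f \o cinv c))) => //.
  by move=> _ [x Ux <-]; rewrite /chart_partial /= cK//; exact: Uc.
by have := smooth_chart cc oU Cf k.+1; rewrite UE; exact: Ck_derive.
Qed.

Lemma differential_chart c U f p : compatible_chart c -> open U -> U p -> cdom c p ->
  smooth U f ->
  differential f p = \sum_i chart_partial c i f p *: differential (ccoord c i) p.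
Proof.
move=> cc oU Up cp Cf; have oc := compatible_open cc; have [[_ _ cK _ _] _] := cc.
pose O := cdom c `&` U; have oO : open O by exact: openI.
have Op : O p by [].
rewrite (@differential_near O f ((f \o cinv c) \o cmap c) p oO Op); last first.
  by move=> x [cx _] /=; rewrite cK.
apply: (@differential_comp O _ (cmap c @` O) (f \o cinv c) (cmap c)) => //.
- by apply: chart_image_open => //; case: cc.
- exact: smooth_chart.
- by move=> j; apply: smooth_sub (smooth_ccoord j cc) => x [].
Qed.

Definition chart_jacobian c p : 'M[R]_m := \matrix_i differential (ccoord c i) p.

(** Expanding the preferred coordinates at p in the chart c yields an inverse. *)
Lemma chart_jacobian_unit c p : compatible_chart c -> cdom c p ->
  chart_jacobian c p \in unitmx.
Proof.
move=> cc cp.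
have op := compatible_open (compatible_chart_at p).
pose A := \matrix_(j, i) chart_partial c i (mcoord p j) p.
suff /mulmx1_unit[] : A *m chart_jacobian c p = 1%:M by [].
apply/row_matrixP => j; rewrite row_mul row1 -(differential_mcoord p j).
rewrite (differential_chart cc op (mem_chart_at p) cp (smooth_ccoord j (compatible_chart_at p))).
rewrite mulmx_sum_row; apply: eq_bigr => i _.
by rewrite rowK; congr (_ *: _); rewrite !mxE.
Qed.

End Smooth.

Section Pairing.
Variables (R : realType) (m : nat).
Implicit Types (v w alpha beta : 'rV[R]_m).

Lemma pairingE v alpha : pairing v alpha = \sum_i v 0 i * alpha 0 i.
Proof. by rewrite /pairing mxE; apply: eq_bigr => i _; rewrite mxE. Qed.

Lemma pairingC v alpha : pairing v alpha = pairing alpha v.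
Proof. by rewrite !pairingE; apply: eq_bigr => i _; rewrite mulrC. Qed.

Lemma pairingDl v w alpha : pairing (v + w) alpha = pairing v alpha + pairing w alpha.
Proof. by rewrite /pairing mulmxDl mxE. Qed.

Lemma pairingZl a v alpha : pairing (a *: v) alpha = a * pairing v alpha.
Proof. by rewrite /pairing -scalemxAl mxE. Qed.

Lemma pairing0l alpha : pairing 0 alpha = 0.
Proof. by rewrite /pairing mul0mx mxE. Qed.

Lemma pairingNl v alpha : pairing (- v) alpha = - pairing v alpha.
Proof. by rewrite -scaleN1r pairingZl mulN1r. Qed.

Lemma pairingDr v alpha beta : pairing v (alpha + beta) = pairing v alpha + pairing v beta.
Proof. by rewrite pairingC pairingDl !(pairingC v). Qed.

Lemma pairingZr a v alpha : pairing v (a *: alpha) = a * pairing v alpha.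
Proof. by rewrite pairingC pairingZl pairingC. Qed.

Lemma pairing0r v : pairing v 0 = 0.
Proof. by rewrite pairingC pairing0l. Qed.

Lemma pairingNr v alpha : pairing v (- alpha) = - pairing v alpha.
Proof. by rewrite pairingC pairingNl pairingC. Qed.

Lemma pairingBr v alpha beta : pairing v (alpha - beta) = pairing v alpha - pairing v beta.
Proof. by rewrite pairingDr pairingNr. Qed.

Lemma pairing_sumr (I : Type) (r : seq I) (P : pred I) v (f : I -> 'rV[R]_m) :
  pairing v (\sum_(i <- r | P i) f i) = \sum_(i <- r | P i) pairing v (f i).
Proof. by elim/big_rec2: _ => [|i y x _ <-]; rewrite ?pairing0r ?pairingDr. Qed.

Lemma pairing_suml (I : Type) (r : seq I) (P : pred I) alpha (f : I -> 'rV[R]_m) :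
  pairing (\sum_(i <- r | P i) f i) alpha = \sum_(i <- r | P i) pairing (f i) alpha.
Proof. by rewrite pairingC pairing_sumr; under eq_bigr do rewrite pairingC. Qed.

Lemma pairing_delta v i : pairing v (delta_mx 0 i) = v 0 i.
Proof.
rewrite pairingE (bigD1 i)//= !mxE !eqxx mulr1 big1 ?addr0// => j ji.
by rewrite !mxE (negPf ji) mulr0.
Qed.

Lemma mulmx_pairing (l : nat) v (G : 'M[R]_(l, m)) i :
  (v *m G^T) 0 i = pairing v (row i G).
Proof. by rewrite pairingE mxE; apply: eq_bigr => j _; rewrite !mxE. Qed.

End Pairing.

Section VectorFields.
Variables (R : realType) (m : nat) (M : manifold R m).
Implicit Types (p x : M) (U W : set M) (f g : M -> R) (c : chart R M m)
  (X Y : M -> 'rV[R]_m).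

Lemma dual_vector c p (w : 'rV[R]_m) : compatible_chart c -> cdom c p ->
  exists v, forall i, pairing v (differential (ccoord c i) p) = w 0 i.
Proof.
move=> cc cp; exists (w *m invmx (chart_jacobian c p)^T) => i.
rewrite -[differential _ _](@rowK _ _ _ (fun i => differential (ccoord c i) p)).
by rewrite -mulmx_pairing mulmxKV// unitmx_tr chart_jacobian_unit.
Qed.

(** * Tangent spaces of submanifolds *)

(** Along the slice only the first k coordinates vary and h is constant, so the
    differential of h is a combination of those of the other coordinates. *)
Lemma slice_annihilates (k : nat) (S : set M) c p U (h : M -> R) (a : R) (v : 'rV[R]_m) :
  slice_chart k S c -> cdom c p -> S p -> open U -> U p -> smooth U h ->
  (forall x, S x -> U x -> h x = a) ->
  (forall i : 'I_m, (k <= i)%N -> pairing v (differential (ccoord c i) p) = 0) ->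
  pairing v (differential h p) = 0.
Proof.
move=> [cc cS] cp Sp oU Up Ch ha vc; have [[oc oi cK _ _] _] := cc.
rewrite (differential_chart cc oU Up cp Ch) pairing_sumr big1// => i _.
rewrite pairingZr; have [/vc->|ik] := leqP k i; first by rewrite mulr0.
suff [_ E] : is_derive (cmap c p) (delta_mx 0 i) (h \o cinv c) 0.
  by rewrite /chart_partial E mul0r.
apply: is_derive_cvg; apply: cvg_near_cst.
have ocU : open (cmap c @` (cdom c `&` U)) by apply: chart_image_open => //; case: cc.
have : \forall t \near (0 : R)^', (cmap c @` (cdom c `&` U)) (t *: delta_mx 0 i + cmap c p).
  apply: (@cvg_line R 'rV[R]_m (delta_mx 0 i) (cmap c p) (cmap c @` (cdom c `&` U))).
  by apply: open_nbhs_nbhs; split=> //; exists p.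
apply: filterS => t /=.
move=> /[dup] /(chart_imageP cc.1)[cy Uy yE] _.
rewrite cK// !ha ?subrr ?mulr0//.
apply/(cS _ cy) => j kj; rewrite /ccoord yE !mxE /=.
rewrite (_ : (j == i) = false) ?mulr0 ?add0r; last first.
  by apply/eqP => ji; rewrite ji leqNgt ik in kj.
by have [+ _] := cS _ cp; apply.
Qed.

Lemma tangent_annihilates (k : nat) (S : set M) p U (h : M -> R) (a : R) (v : 'rV[R]_m) :
  tangent k S p v -> S p -> open U -> U p -> smooth U h ->
  (forall x, S x -> U x -> h x = a) -> pairing v (differential h p) = 0.
Proof.
move=> [c [sc cp vc]] Sp oU Up Ch ha; exact: slice_annihilates sc cp Sp oU Up Ch ha vc.
Qed.

(** The definition of tangent spaces allows any slice chart at p. All choices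
    agree: the slice functions of one chart vanish on S, so they are killed by
    the vectors tangent to the slice of another one. *)
Lemma tangentP (k : nat) (S : set M) c p (v : 'rV[R]_m) :
  slice_chart k S c -> cdom c p -> S p ->
  tangent k S p v <->
  forall i : 'I_m, (k <= i)%N -> pairing v (differential (ccoord c i) p) = 0.
Proof.
move=> sc cp Sp; split=> [tv i ki|H]; last by exists c.
have [cc cS] := sc.
apply: (tangent_annihilates tv Sp (compatible_open cc) cp (smooth_ccoord i cc)).
by move=> x Sx cx; have [+ _] := cS x cx; apply.
Qed.

(** * Vector fields as derivations *)

Lemma smooth_vf_sub U W X : W `<=` U -> smooth_vf U X -> smooth_vf W X.
Proof. by move=> WU CX W' f oW' W'W; apply: CX => // x /W'W /WU. Qed.

Lemma vf_act_near X U f g p : open U -> U p -> (forall x, U x -> f x = g x) ->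
  vf_act X f p = vf_act X g p.
Proof. by move=> oU Up fg; rewrite /vf_act (differential_near oU Up fg). Qed.

Lemma vf_act_mcoord X p i : vf_act X (mcoord p i) p = X p 0 i.
Proof. by rewrite /vf_act differential_mcoord pairing_delta. Qed.

Lemma vf_actE X f p : vf_act X f p = \sum_i X p 0 i * differential f p 0 i.
Proof. exact: pairingE. Qed.

Lemma vf_act_chart X c U f p : compatible_chart c -> open U -> U p -> cdom c p ->
  smooth U f ->
  vf_act X f p = \sum_i chart_partial c i f p * vf_act X (ccoord c i) p.
Proof.
move=> cc oU Up cp Cf.
rewrite /vf_act (differential_chart cc oU Up cp Cf) pairing_sumr.
by apply: eq_bigr => i _; rewrite pairingZr.
Qed.

Lemma chart_partial_at p i f : chart_partial (chart_at p) i f p = differential f p 0 i.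
Proof. by rewrite mxE. Qed.

(* the Hessian of f at p in the preferred coordinates at p *)
Let hessian f p i j := differential (chart_partial (chart_at p) i f) p 0 j.

Let hessian_sym U f p i j : open U -> U p -> smooth U f -> hessian f p i j = hessian f p j i.
Proof.
move=> oU Up Cf; have [oc oi cK _ _] := chart_atP p.
pose c := chart_at p; pose V := cmap c @` (cdom c `&` U).
have oV : open V by apply: chart_image_open => //; exact: chart_atP.
have Vp : V (cmap c p) by exists p => //; split=> //; exact: mem_chart_at.
have E a b : hessian f p a b =
    'D_(delta_mx 0 b) ('D_(delta_mx 0 a) (f \o cinv c)) (cmap c p).
  rewrite /hessian mxE; apply: near_eq_derive.
  apply: (open_near oV Vp) => z /(chart_imageP (chart_atP p))[_ _ zE].
  by rewrite /chart_partial /= zE.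
rewrite !E; apply: (derive_comm _ _ oV) => //.
exact: Cf.
Qed.

Let second_derivative U X Y f p : open U -> U p -> smooth_vf U X -> smooth_vf U Y ->
  smooth U f ->
  vf_act X (vf_act Y f) p =
    \sum_i differential f p 0 i * vf_act X (vf_act Y (mcoord p i)) p
    + \sum_i \sum_j Y p 0 i * (X p 0 j * hessian f p i j).
Proof.
move=> oU Up CX CY Cf; pose c := chart_at p.
have cc := compatible_chart_at p; have oc := compatible_open cc.
have cp := mem_chart_at p.
pose W := U `&` cdom c; have oW : open W by exact: openI.
have Wp : W p by [].
have WU : W `<=` U by move=> x [].
have Wc : W `<=` cdom c by move=> x [].
have CfW := smooth_sub WU Cf.
pose F i x := chart_partial c i f x * vf_act Y (mcoord p i) x.
have C1 i : smooth W (chart_partial c i f) by exact: smooth_chart_partial.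
have C2 i : smooth W (vf_act Y (mcoord p i)).
  by apply: CY => //; apply: smooth_sub (smooth_ccoord i cc).
have CF i : smooth W (F i) by exact: smoothM.
rewrite (@vf_act_near X W _ (fun x => \sum_i F i x) p oW Wp); last first.
  by move=> x [Ux cx]; exact: (vf_act_chart _ cc oU Ux cx Cf).
rewrite /vf_act (differential_sum _ oW Wp CF) pairing_sumr -big_split.
apply: eq_bigr => i _ /=.
rewrite (differentialM Wp (C1 i) (C2 i)) pairingDr !pairingZr.
rewrite chart_partial_at -/(vf_act _ _ _); congr (_ + _).
by rewrite -/(vf_act _ _ _) vf_act_mcoord; rewrite -?/(vf_act _ _ _) ?vf_actE ?pairingE mulr_sumr.
Qed.

(** The second-order terms of the composites of two derivations cancel in the
    commutator, by the symmetry of second derivatives. *)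
Lemma commutator_derivation U X Y f p : open U -> U p ->
  smooth_vf U X -> smooth_vf U Y -> smooth U f ->
  vf_act X (vf_act Y f) p - vf_act Y (vf_act X f) p =
  \sum_i differential f p 0 i *
    (vf_act X (vf_act Y (mcoord p i)) p - vf_act Y (vf_act X (mcoord p i)) p).
Proof.
move=> oU Up CX CY Cf.
rewrite (second_derivative oU Up CX CY Cf) (second_derivative oU Up CY CX Cf).
rewrite [X in _ - (_ + X)]exchange_big /= opprD addrACA.
rewrite [X in _ + X](_ : _ = 0) ?addr0.
  by rewrite -sumrB; apply: eq_bigr => i _; rewrite mulrBr.
apply/eqP; rewrite subr_eq0; apply/eqP; apply: eq_bigr => i _; apply: eq_bigr => j _.
by rewrite (hessian_sym j i oU Up Cf) mulrCA.
Qed.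

End VectorFields.

(** * Charts with prescribed coordinate functions *)

Section ChartOfFunctions.
Variables (R : realType) (m : nat) (M : manifold R m).

(** The inverse function theorem for the expression of g in the preferred chart
    at p. *)
Lemma chart_of_functions (p : M) (U : set M) (g : 'I_m -> M -> R) :
  open U -> U p -> (forall i, smooth U (g i)) ->
  \matrix_i differential (g i) p \in unitmx ->
  exists (c : chart R M m) (e : R),
    [/\ 0 < e, compatible_chart c, cdom c p /\ cdom c `<=` U,
        cmap c @` cdom c = ball (\row_i g i p) e &
        forall x, cmap c x = \row_i g i x].
Proof.
move=> oU Up Cg gunit; pose c0 := chart_at p.
have cc0 := chart_atP p; have [od0 oi0 K0 cont0 icont0] := cc0.
have c0p : cdom c0 p := mem_chart_at p.
pose V := cmap c0 @` (cdom c0 `&` U).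
have oV : open V by exact: chart_image_open.
pose Phi (z : 'rV[R]_m) : 'rV[R]_m := \row_i g i (cinv c0 z).
have PhiE i : (fun z => Phi z 0 i) = g i \o cinv c0.
  by apply/funext => z; rewrite mxE.
have CPhi i : Cinf V (fun z => Phi z 0 i) by rewrite PhiE; exact: Cg.
have Junit : jacobian_rV Phi (cmap c0 p) \in unitmx.
  rewrite -unitmx_tr (_ : _^T = \matrix_i differential (g i) p)//.
  by apply/matrixP => i j; rewrite !mxE PhiE.
have [|e e0 [W [psi [oW [Wp WV] WP psiP Cpsi]]]] := inverse_function oV _ CPhi Junit.
  by exists p.
have PhiK x : cdom c0 x -> Phi (cmap c0 x) = \row_i g i x.
  by move=> cx; apply/rowP => i; rewrite !mxE K0.
have Phip : Phi (cmap c0 p) = \row_i g i p by exact: PhiK.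
rewrite Phip in WP psiP Cpsi.
pose B := ball (\row_i g i p) e; have oB : open B by exact: ball_open.
pose dom := [set x | cdom c0 x /\ W (cmap c0 x)].
have domU : dom `<=` U.
  by move=> x [cx /WV[y [cy Uy] E]]; rewrite -(K0 x cx) -E K0.
pose c := Chart dom (fun x => \row_i g i x : 'rV[R]_m) (cinv c0 \o psi).
have domB x : dom x -> B (cmap c x) /\ psi (cmap c x) = cmap c0 x.
  by move=> [cx /WP[b E]]; move: b E; rewrite /= PhiK.
have Bdom y : B y -> dom (cinv c y) /\ cmap c (cinv c y) = y.
  move=> /psiP[Wy E]; have [x [cx Ux] xE] := WV _ Wy.
  have xE' : cinv c y = x by rewrite /= -xE K0.
  rewrite xE'; split; first by split=> //; rewrite xE.
  by rewrite -[RHS]E -xE /= PhiK.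
have imB : cmap c @` dom = B.
  apply/seteqP; split=> [_ [x /domB[b _] <-]//|y /Bdom[d E]].
  by exists (cinv c y).
have odom : open dom.
  rewrite openE => x [cx Wx]; rewrite /interior.
  have n1 : nbhs x (cdom c0) by exact: open_nbhs_nbhs.
  have n2 : nbhs x (cmap c0 @^-1` W) by apply: (cont0 x cx); exact: open_nbhs_nbhs.
  exact: filterI n1 n2.
have cc : is_chart c.
  split=> //.
  - by rewrite imB.
  - by move=> x dx; have [_ E] := domB x dx; rewrite /= -[psi _]/(psi (cmap c x)) E K0//; case: dx.
  - move=> x dx; apply: continuous_rV => j.
    rewrite (_ : (fun y => _) = g j); last by apply/funext => y; rewrite mxE.
    exact: smooth_continuous oU (Cg j) (domU _ dx).
  - move=> x dx; have [Bx E] := domB x dx; apply: continuous_comp.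
      by apply: continuous_rV => j; exact: Ck_continuous (Cpsi j 0) Bx.
    by rewrite /= -[psi _]/(psi (cmap c x)) E; apply: icont0; case: dx.
exists c, e; split=> //; split=> // r; split.
  move=> i; rewrite (_ : ccoord c i = g i); last first.
    by apply/funext => y; rewrite /ccoord mxE.
  move=> k; apply: Ck_sub (Cg i r k) => _ [x [rx dx] <-].
  by exists x => //; split=> //; exact: domU.
move=> j k; apply: (@Ck_comp _ _ _ _ _ (cmap c0 @` (cdom c0 `&` cdom (chart_at r)))
    (ccoord (chart_at r) j \o cinv c0) psi).
- by apply: chart_image_open => //; case: (chart_atP r).
- by apply: chart_image_open => //; case: (chart_atP r).
- move=> _ [x [dx rx] <-]; have [_ ->] := domB x dx.
  by exists x => //; split=> //; case: dx.
- exact: chart_at_smooth.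
- by move=> i; apply: Ck_sub (Cpsi i k) => _ [x [/domB[b _] _] <-].
Qed.

End ChartOfFunctions.

Lemma mulmx_pid_mx (R : fieldType) (p m r : nat) (A : 'M[R]_(p, m)) :
  (forall i (j : 'I_m), (r <= j)%N -> A i j = 0) -> A *m pid_mx r = A.
Proof.
move=> A0; apply/matrixP => i j; rewrite mxE (bigD1 j)//= !mxE eqxx /=.
rewrite big1 ?addr0; last first.
  by move=> k kj; rewrite mxE (_ : (_ == _) = false) ?mulr0//; exact/negbTE.
by case: ltnP => [_|/A0->]; rewrite ?mulr1 ?mul0r.
Qed.

Lemma rank_vanishing_columns (R : fieldType) (p m r : nat) (A : 'M[R]_(p, m)) :
  (r <= m)%N -> (forall i (j : 'I_m), (r <= j)%N -> A i j = 0) -> (\rank A <= r)%N.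
Proof.
move=> rm /mulmx_pid_mx <-; apply: leq_trans (mxrankM_maxr _ _) _.
by rewrite rank_pid_mx.
Qed.

(** The first r rows of G0, which are zero, make room for a basis of a complement
    of the row space of G0: by the assumption on the left kernel of G0, this
    complement has dimension at most r. *)
Lemma complete_first_rows (R : fieldType) (m r : nat) (G0 : 'M[R]_m) :
  (r <= m)%N ->
  (forall i : 'I_m, (i < r)%N -> row i G0 = 0) ->
  (forall u : 'rV_m, u *m G0 = 0 -> forall i : 'I_m, (r <= i)%N -> u 0 i = 0) ->
  exists Y : 'M[R]_m,
    \matrix_(i < m) (if (i < r)%N then row i Y else row i G0) \in unitmx.
Proof.
move=> rm G00 ker.
pose W := row_base (G0^C)%MS.
have rkW : (\rank (G0^C)%MS <= r)%N.
  rewrite mxrank_compl -mxrank_ker; apply: rank_vanishing_columns => // i j rj.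
  have := ker (row i (kermx G0)); rewrite -row_mul mulmx_ker row0 => /(_ erefl j rj).
  by rewrite mxE.
pose Y : 'M[R]_m := \matrix_(i < m) oapp (fun a => row a W) 0 (insub (i : nat)).
exists Y; set G := \matrix_i _.
have G0G : (G0 <= G)%MS.
  apply/row_subP => i; have [ir|ri] := ltnP i r; first by rewrite G00// sub0mx.
  have -> : row i G0 = row i G by rewrite rowK ltnNge ri.
  exact: row_sub.
have WG : (G0^C <= G)%MS.
  apply: (@submx_trans _ _ _ _ _ _ W); first by rewrite eq_row_base.
  apply/row_subP => a.
  have am : (a < m)%N by apply: leq_trans (ltn_ord a) (leq_trans rkW rm).
  have ar : (a < r)%N by apply: leq_trans (ltn_ord a) rkW.
  have -> : row a W = row (Ordinal am) G.
    rewrite rowK /= ar rowK /=; case: insubP => [b _ ab|]; last by rewrite ltn_ord.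
    by congr (row _ W); apply/val_inj.
  exact: row_sub.
have : row_full G.
  by rewrite -sub1mx; apply: submx_trans (_ : G0 + G0^C <= G)%MS;
     [rewrite sub1mx addsmx_compl_full|rewrite addsmx_sub G0G].
by rewrite row_full_unit.
Qed.

(** * Submersions in adapted charts *)

Section SubmersionChart.
Variables (R : realType) (m : nat) (M : manifold R m).

(** The differentials of h are independent on the tangent space of S at p, where
    those of the slice functions of S vanish. So both families together are
    independent, and k - l linear combinations of coordinates, placed first,
    complete them to a chart. *)
Lemma submersion_chart (k l : nat) (S : set M) (p : M) (U : set M) (h : 'I_l -> M -> R) :
  submanifold k S -> S p -> open U -> U p -> (forall j, smooth U (h j)) ->
  (forall w : 'rV[R]_l, exists2 v, tangent k S p v &
     forall j, pairing v (differential (h j) p) = w 0 j) ->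
  exists (c : chart R M m) (e : R),
    [/\ (l <= k <= m)%N /\ 0 < e, slice_chart k S c /\ cdom c `<=` U,
        cdom c p /\ cmap c p = 0, cmap c @` cdom c = ball 0 e &
        forall (i : 'I_m) (j : 'I_l), i = (k - l + j)%N :> nat ->
          forall x, ccoord c i x = h j x - h j p].
Proof.
move=> [km Ssub] Sp oU Up Ch hsurj.
have [b [sb bp]] := Ssub p Sp; have [cb bS] := sb.
have ob := compatible_open cb.
have jb := chart_jacobian_unit cb bp.
have /choice[v vP] : forall j : 'I_l, exists v, tangent k S p v /\
    forall j', pairing v (differential (h j') p) = (delta_mx 0 j : 'rV[R]_l) 0 j'.
  by move=> j; have [v tv vh] := hsurj (delta_mx 0 j); exists v.
(* expressed in the chart b, the vectors v lie in the span of the first k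
   coordinate vectors *)
have lk : (l <= k)%N.
  pose H : 'M[R]_(l, m) := \matrix_j differential (h j) p.
  pose V : 'M[R]_(l, m) := \matrix_j v j.
  have VH : V *m H^T = 1%:M.
    apply/row_matrixP => j; rewrite row_mul rowK row1; apply/rowP => j'.
    by rewrite mulmx_pairing rowK; have [_ ->] := vP j.
  have ub : (chart_jacobian b p)^T \in unitmx by rewrite unitmx_tr.
  have rk : (\rank (V *m (chart_jacobian b p)^T) <= k)%N.
    apply: rank_vanishing_columns => // j i ki.
    have -> : (V *m (chart_jacobian b p)^T) j i =
        (v j *m (chart_jacobian b p)^T) 0 i.
      by rewrite -[v j](rowK v) -row_mul [RHS]mxE.
    rewrite mulmx_pairing rowK; have [tv _] := vP j.
    by have [+ _] := tangentP (v j) sb bp Sp; apply.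
  apply: leq_trans rk; rewrite -[leqLHS](mxrank1 R) -VH.
  have -> : V *m H^T = V *m (chart_jacobian b p)^T *m
      (invmx (chart_jacobian b p)^T *m H^T) by rewrite mulmxA mulmxK.
  exact: mxrankM_maxl.
pose r := (k - l)%N.
have rm : (r <= m)%N by apply: leq_trans (leq_subr _ _) km.
pose hh (i : nat) : M -> R := oapp h (fun=> 0) (insub (i - r)%N).
pose G0 : 'M[R]_m := \matrix_(i < m) (if (i < r)%N then 0 else
  if (i < k)%N then differential (hh i) p else differential (ccoord b i) p).
have hhE (i : 'I_m) (j : 'I_l) : i = (r + j)%N :> nat -> hh i = h j.
  move=> ij; rewrite /hh ij addKn; case: insubP => [j' _ jj'|]; last by rewrite ltn_ord.
  by congr h; apply/val_inj.
have jI (i : 'I_m) : (r <= i)%N -> (i < k)%N -> exists j : 'I_l, i = (r + j)%N :> nat.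
  move=> ri ik; have il : (i - r < l)%N by rewrite ltn_subLR// subnK.
  by exists (Ordinal il); rewrite /= subnKC.
have [||Y Yunit] := @complete_first_rows R m r G0 rm.
- by move=> i ir; rewrite rowK ir.
- move=> u uG.
  have pu (w : 'rV[R]_m) : \sum_i u 0 i * pairing w (row i G0) = 0.
    rewrite -[RHS](pairing0r w) -uG mulmx_sum_row pairing_sumr.
    by apply: eq_bigr => i _; rewrite pairingZr.
  have u1 (i : 'I_m) : (r <= i)%N -> (i < k)%N -> u 0 i = 0.
    move=> ri ik; have [j ij] := jI i ri ik; have [tv vh] := vP j.
    have := pu (v j); rewrite (bigD1 i)//= rowK ltnNge ri /= ik (hhE i j ij) vh.
    rewrite mxE !eqxx mulr1 big1 ?addr0// => i' ii'.
    rewrite rowK; case: (ltnP i' r) => [_|ri']; first by rewrite pairing0r mulr0.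
    case: ltnP => [ik'|ki']; last first.
      by have [+ _] := tangentP (v j) sb bp Sp; move=> -> //; rewrite mulr0.
    have [j' ij'] := jI i' ri' ik'; rewrite (hhE i' j' ij') vh mxE eqxx /=.
    rewrite (_ : (_ == _) = false) ?mulr0//; apply: contraNF ii' => /eqP jj'.
    by apply/eqP/val_inj; rewrite /= ij ij' jj'.
  move=> i ri; have [|ki] := ltnP i k; first exact: u1.
  have [w wP] := dual_vector (delta_mx 0 i) cb bp.
  have := pu w; rewrite (bigD1 i)//= rowK ltnNge ri /= ltnNge ki /= wP.
  rewrite mxE !eqxx mulr1 big1 ?addr0// => i' ii'.
  rewrite rowK; case: (ltnP i' r) => [_|ri']; first by rewrite pairing0r mulr0.
  case: ltnP => [ik'|ki']; first by rewrite u1// mul0r.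
  by rewrite wP mxE (negPf ii') andbF mulr0.
pose y (i : 'I_m) (x : M) := \sum_a Y i a * (mcoord p a x - mcoord p a p).
pose g (i : 'I_m) : M -> R := if (i < r)%N then y i else
  if (i < k)%N then (fun x => hh i x - hh i p) else ccoord b i.
pose O := U `&` cdom b `&` cdom (chart_at p).
have op := compatible_open (compatible_chart_at p).
have oO : open O by apply: openI => //; exact: openI.
have Op : O p by split=> //; exact: mem_chart_at.
have OU : O `<=` U by move=> x [[]].
have Chh i : smooth O (hh i).
  rewrite /hh; case: insub => [j|] /=; last exact: smooth_cst.
  exact: smooth_sub (Ch j).
have Cx a : smooth O (mcoord p a).
  by apply: smooth_sub (smooth_ccoord a (compatible_chart_at p)) => x [].
have Cxx a : smooth O (fun x => mcoord p a x - mcoord p a p).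
  by apply: smoothB => //; exact: smooth_cst.
have Cg i : smooth O (g i).
  rewrite /g; case: ifP => _.
    by apply: (@smooth_sum _ _ _ _ _ _ _ (fun a x => Y i a * (mcoord p a x - mcoord p a p))) => // a _; exact: smoothZ.
  case: ifP => _; first by apply: smoothB => //; exact: smooth_cst.
  by apply: smooth_sub (smooth_ccoord i cb) => x [[]].
have gunit : \matrix_i differential (g i) p \in unitmx.
  rewrite (_ : \matrix_i _ = \matrix_(i < m) (if (i < r)%N then row i Y else row i G0))//.
  apply/row_matrixP => i; rewrite !rowK /g; case: ltnP => ir.
    rewrite (@differential_sum _ _ _ O _ _ (fun a x => Y i a * (mcoord p a x - mcoord p a p)) _ oO Op); last first.
      by move=> a; exact: smoothZ.
    rewrite [RHS]row_sum_delta; apply: eq_bigr => a _.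
    rewrite (differentialZ _ Op (Cxx a)) mxE; congr (_ *: _).
    rewrite (differentialB oO Op (Cx a) (smooth_cst _ oO)) differential_cst subr0.
    exact: differential_mcoord.
  case: ltnP => // ik.
  by rewrite (differentialB oO Op (Chh i) (smooth_cst _ oO)) differential_cst subr0.
have g0 : \row_i g i p = 0.
  apply/rowP => i; rewrite !mxE /g; case: ltnP => [_|ri].
    by rewrite /y big1// => a _; rewrite subrr mulr0.
  case: ltnP => [_|ki]; first by rewrite subrr.
  by have [+ _] := bS p bp; apply.
have [c [e [e0 cc [cp cO] cim cE]]] := chart_of_functions oO Op Cg gunit.
rewrite g0 in cim; exists c, e; split=> //; first by split=> //; rewrite lk.
- split; last by move=> x /cO /OU.
  split=> // x cx; have [[_ bx] _] := cO x cx.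
  have gE (i : 'I_m) : (k <= i)%N -> ccoord c i x = ccoord b i x.
    move=> ki; rewrite /ccoord cE mxE /g.
    by rewrite ltnNge (leq_trans (leq_subr _ _) ki) /= ltnNge ki.
  rewrite (bS x bx); split=> H i ki; first by rewrite gE// H.
  by rewrite -gE// H.
- by split=> //; rewrite cE.
move=> i j ij x; rewrite /ccoord cE mxE /g.
have ik : (i < k)%N by rewrite ij -[X in (_ < X)%N](subnK lk) ltn_add2l.
by rewrite ik (hhE i j ij) ltnNge ij leq_addr.
Qed.

End SubmersionChart.

(** * Leaves *)

Lemma locally_constant_connected (T : topologicalType) (Y : Type) (N : set T) (b : T -> Y) :
  connected N -> (forall x, N x -> \forall y \near x, N y -> b y = b x) ->
  forall x y, N x -> N y -> b y = b x.
Proof.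
move=> cN lc x y Nx Ny.
pose O (x : T) : set T := [set y | N y -> b y = b x]°.
have oO z : open (O z) by exact: open_interior.
have OO z : N z -> O z z by move=> Nz; exact: lc.
pose B := [set z | N z /\ b z = b x].
suff BN : B = N by have [] : B y by rewrite BN.
apply: cN.
- by exists x.
- exists (\bigcup_(z in B) O z); first by apply: bigcup_open => z _; exact: oO.
  apply/seteqP; split=> z.
    by move=> [Nz bz]; split=> //; exists z => //; exact: OO.
  by move=> [Nz [z' [Nz' bz'] /interior_subset /(_ Nz) E]]; split=> //; rewrite E.
- exists (~` \bigcup_(z in N `\` B) O z).
    by apply: open_closedC; apply: bigcup_open => z _; exact: oO.
  apply/seteqP; split=> z.
    move=> [Nz bz]; split=> // -[z' [Nz' nB] /interior_subset /(_ Nz) E].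
    by apply: nB; split=> //; rewrite -E.
  move=> [Nz H]; apply: contrapT => nB; apply: H; exists z; first by split.
  exact: OO.
Qed.

Section Leaves.
Variables (R : realType) (m : nat) (M : manifold R m).

(** In a slice chart of N, the mean value theorem between two points of N only
    involves points of N and derivatives in directions tangent to N. *)
Lemma integral_locally_constant (r : nat) (S : set M) (B : M -> set 'rV[R]_m)
    (N U : set M) (u : M -> R) (x : M) :
  connected_integral_manifold r S B N ->
  open U -> smooth U u -> U x -> N x ->
  (forall y, S y -> U y -> forall v, B y v -> pairing v (differential u y) = 0) ->
  \forall y \near x, N y -> u y = u x.
Proof.
move=> [[rm Nsub] NS _ NB] oU Cu Ux Nx du.
have [c [sc cx]] := Nsub x Nx; have [cc cN] := sc.
have [[oc _ cK ccont _] _] := cc.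
pose V := cmap c @` (cdom c `&` U).
have oV : open V by apply: chart_image_open => //; case: cc.
have Vx : V (cmap c x) by exists x.
have /nbhs_ballP[e /= e0 eV] := open_nbhs_nbhs (conj oV Vx).
have n1 : nbhs x (cdom c) by exact: open_nbhs_nbhs.
have n2 : nbhs x (cmap c @^-1` ball (cmap c x) e).
  by apply: (ccont x cx); exact: nbhsx_ballx.
apply: filterS (filterI n1 n2) => y [cy yb] Ny.
have Cf := smooth_chart cc oU Cu.
have [|xi xib] := @mean_value R m (u \o cinv c) (cmap c x) (cmap c y).
  move=> z zb i; apply: Ck_derivable (Cf 1) _.
  by apply: eV; apply: box_ball zb => //; exact: ballxx.
rewrite /= !cK// => E; apply/eqP; rewrite -subr_eq0 E; apply/eqP.
have slice0 z (i : 'I_m) : N z -> cdom c z -> (r <= i)%N -> ccoord c i z = 0.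
  by move=> Nz cz; have [+ _] := cN z cz; apply.
apply: big1 => j _; have [rj|jr] := leqP r j.
  have := slice0 y j Ny cy rj; have := slice0 x j Nx cx rj.
  by rewrite /ccoord => -> ->; rewrite subrr mul0r.
have /(chart_imageP cc.1)[cw Uw wE] : V (xi j).
  by apply: eV; apply: box_ball (xib j) => //; exact: ballxx.
set w := cinv c (xi j) in cw Uw wE.
have Nw : N w.
  apply/(cN w cw) => i ri; rewrite /ccoord wE.
  have := xib j i; have := slice0 y i Ny cy ri; have := slice0 x i Nx cx ri.
  by rewrite /ccoord => -> ->; lra.
have [v vP] := dual_vector (delta_mx 0 j) cc cw.
have Bv : B w v.
  rewrite -(NB w Nw); apply/(tangentP v sc cw Nw) => i ri; rewrite vP mxE eqxx /=.
  by rewrite (_ : (i == j) = false)//; apply/eqP => ij; rewrite ij leqNgt jr in ri.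
have := du w (NS w Nw) Uw v Bv.
rewrite (differential_chart cc oU Uw cw Cu) pairing_sumr (bigD1 j)//= pairingZr vP.
rewrite mxE !eqxx mulr1 big1 ?addr0.
  by rewrite /chart_partial wE => ->; rewrite mulr0.
by move=> i ij; rewrite pairingZr vP mxE (negPf ij) andbF mulr0.
Qed.

(** Points of a leaf are joined by chains of connected integral manifolds, and a
    locally constant function on a connected set is constant. *)
Lemma same_leaf_constant (r : nat) (S : set M) (B : M -> set 'rV[R]_m) (b : M -> R) :
  (forall x, S x -> exists (U : set M) (u : M -> R),
     [/\ open U, U x, smooth U u, forall y, S y -> U y -> b y = u y &
         forall y, S y -> U y -> forall v, B y v -> pairing v (differential u y) = 0]) ->
  forall x y, same_leaf r S B x y -> b x = b y.
Proof.
move=> bP x y; elim=> [{}x {}y [N [iN Nx Ny]]|//|{}x {}y z _ -> _ //].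
have [_ NS cN _] := iN.
apply: (locally_constant_connected cN) => // z Nz.
have [U [u [oU Uz Cu bu du]]] := bP z (NS z Nz).
have n1 := integral_locally_constant iN oU Cu Uz Nz du.
have n2 : nbhs z U by exact: open_nbhs_nbhs.
apply: filterS (filterI n1 n2) => w [H Uw] Nw.
by rewrite (bu z (NS z Nz) Uz) (bu w (NS w Nw) Uw) H.
Qed.

Definition plaque (c : chart R M m) (r : nat) (z : M) : set M :=
  [set x | cdom c x /\ forall i : 'I_m, (r <= i)%N -> ccoord c i x = ccoord c i z].

(** In the chart, the plaque is the section of a ball by an affine subspace, and
    its points are joined to z by segments. *)
Lemma plaque_connected (c : chart R M m) (r : nat) (e : R) (z : M) :
  compatible_chart c -> cmap c @` cdom c = ball 0 e -> cdom c z ->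
  connected (plaque c r z).
Proof.
move=> cc cim cz; have [[oc oi cK ccont icont] _] := cc.
pose path (x : M) (t : R) := cinv c (t *: (cmap c x - cmap c z) + cmap c z).
have pathB x t : cdom c x -> 0 <= t <= 1 ->
    ball 0 e (t *: (cmap c x - cmap c z) + cmap c z).
  move=> cx t01; apply: (@box_ball _ _ (cmap c z) (cmap c x)).
  - by rewrite -cim; exists z.
  - by rewrite -cim; exists x.
  move=> i; rewrite !mxE; set a := cmap c z 0 i; set b := cmap c x 0 i.
  have [ab|ba] := leP a b; apply/orP; [left|right]; nra.
have -> : plaque c r z = \bigcup_(x in plaque c r z) (path x @` `[0, 1]).
  apply/seteqP; split=> [x Nx|y [x [cx xz] [t /= t01 <-]]].
    exists x => //; exists 1; first by rewrite /= in_itv /= ler01 lexx.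
    by rewrite /path scale1r subrK cK//; case: Nx.
  rewrite in_itv /= in t01; have := pathB x t cx t01; rewrite -cim => -[w cw wE].
  split; first by rewrite /path -wE cK.
  move=> i ri; rewrite /path -wE cK// /ccoord wE !mxE.
  by have := xz i ri; rewrite /ccoord => ->; rewrite subrr mulr0 add0r.
apply: bigcup_connected.
  exists z => x [cx _]; exists 0; first by rewrite /= in_itv /= lexx ler01.
  by rewrite /path scale0r add0r cK.
move=> x [cx _]; apply: connected_continuous_connected.
  exact: segment_connected.
apply: continuous_in_subspaceT => t; rewrite inE /= in_itv /= => t01.
apply: (@continuous_comp _ _ _ (fun t : R => t *: (cmap c x - cmap c z) + cmap c z)).
  apply: (@continuousD _ _ _ (fun t : R => t *: (cmap c x - cmap c z)) (fun=> cmap c z)).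
    exact: scalel_continuous.
  exact: cst_continuous.
have := pathB x t cx t01; rewrite -cim => -[w cw <-].
exact: icont.
Qed.

(** Translating the coordinates of c so that they vanish at z gives slice charts
    of the plaque. *)
Lemma plaque_integral (c : chart R M m) (r : nat) (e : R) (z : M) (S : set M)
    (B : M -> set 'rV[R]_m) :
  (r <= m)%N -> compatible_chart c -> cmap c @` cdom c = ball 0 e -> cdom c z ->
  plaque c r z `<=` S ->
  (forall x, plaque c r z x -> B x = [set v | forall i : 'I_m, (r <= i)%N ->
      pairing v (differential (ccoord c i) x) = 0]) ->
  connected_integral_manifold r S B (plaque c r z).
Proof.
move=> rm cc cim cz zS BE; have oc := compatible_open cc.
pose g i x := ccoord c i x - ccoord c i z.
have Cc i := smooth_ccoord i cc.
have Cg i : smooth (cdom c) (g i) by apply: smoothB => //; exact: smooth_cst.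
have dg i x : cdom c x -> differential (g i) x = differential (ccoord c i) x.
  move=> cx; rewrite (differentialB oc cx (Cc i) (smooth_cst _ oc)).
  by rewrite differential_cst subr0.
have slice x : plaque c r z x -> exists c' : chart R M m,
    [/\ slice_chart r (plaque c r z) c', cdom c' x & forall i, ccoord c' i = g i].
  move=> [cx _].
  have gunit : \matrix_i differential (g i) x \in unitmx.
    rewrite (_ : \matrix_i _ = chart_jacobian c x); first exact: chart_jacobian_unit.
    by apply/row_matrixP => i; rewrite !rowK dg.
  have [c' [e' [_ cc' [c'x c'c] _ c'E]]] := chart_of_functions oc cx Cg gunit.
  have c'g i : ccoord c' i = g i by apply/funext => y; rewrite /ccoord c'E mxE.
  exists c'; split=> //; split=> // y /c'c cy; split=> [[_ H] i ri|H].
    by rewrite c'g /g H// subrr.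
  by split=> // i ri; have := H i ri; rewrite c'g => /eqP; rewrite subr_eq0 => /eqP.
split=> //.
- by split=> // x /slice[c' [sc' c'x _]]; exists c'.
- exact: plaque_connected cim cz.
move=> x Nx; rewrite BE//; have [c' [sc' c'x c'g]] := slice x Nx.
have [cx _] := Nx.
apply/seteqP; split=> v.
  by move/(tangentP v sc' c'x Nx) => H i ri; have := H i ri; rewrite c'g dg.
by move=> H; apply/(tangentP v sc' c'x Nx) => i ri; rewrite c'g dg// H.
Qed.

End Leaves.

(** * Existence of adapted extensions *)

(** Reads off the rank of a distribution from a chart in which it is spanned by
    the first r coordinate vectors. *)
Lemma kernel_dimension (R : realType) (m r s : nat) (G : 'M[R]_m) (X : 'M[R]_(s, m)) :
  G \in unitmx -> row_free X -> (r <= m)%N ->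
  (forall v : 'rV_m, (v <= X)%MS <->
     forall i : 'I_m, (r <= i)%N -> pairing v (row i G) = 0) ->
  s = r.
Proof.
move=> uG /eqP rX rm XE; have uGT : G^T \in unitmx by rewrite unitmx_tr.
apply/eqP; rewrite -rX eqn_leq; apply/andP; split.
  rewrite -(mxrankMfree X (_ : row_free G^T)) ?row_free_unit//.
  apply: rank_vanishing_columns => // i j rj.
  have -> : (X *m G^T) i j = (row i X *m G^T) 0 j by rewrite -row_mul [RHS]mxE.
  by rewrite mulmx_pairing; exact: ((XE _).1 (row_sub i X) j rj).
pose Y : 'M[R]_m := pid_mx r *m invmx G^T.
have <- : \rank Y = r.
  by rewrite mxrankMfree ?row_free_unit ?unitmx_inv// rank_pid_mx.
apply: mxrankS; apply/row_subP => i; apply/XE => j rj.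
rewrite -mulmx_pairing /Y row_mul mulmxKV// !mxE.
by rewrite (_ : (_ && _) = false)//; apply/negbTE; rewrite negb_and; case: eqP => //= ->; rewrite -leqNgt.
Qed.

(** The matrix N = Z T (S Z T)^-1 S satisfies N Z = Z, because Z and S Z have the
    same rank and thus the same row space. The rows of 1 - N therefore annihilate
    Z, and so they annihilate rho. The solution is a smooth function of Z and
    rho, which is what linear systems with parameters require. *)
Lemma constant_rank_solution (R : fieldType) (r m k : nat) (Z : 'M[R]_(r, m))
    (rho : 'cV[R]_r) (S : 'M[R]_(k, r)) (T : 'M[R]_(m, k)) :
  \rank Z = k -> S *m Z *m T \in unitmx ->
  (forall a : 'rV_r, a *m Z = 0 -> a *m rho = 0) ->
  Z *m (T *m invmx (S *m Z *m T) *m (S *m rho)) = rho.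
Proof.
move=> rZ uSZT ker.
have /submxP[Y YE] : (Z <= S *m Z)%MS.
  have rSZ : (k <= \rank (S *m Z))%N.
    by rewrite -{1}(mxrank_unit uSZT); exact: mxrankM_maxl.
  have := mxrank_leqif_sup (submxMl S Z); rewrite rZ => /leqifP.
  by case: ifP => // _; rewrite ltnNge rSZ.
pose N := Z *m T *m invmx (S *m Z *m T) *m S.
have NZ : (1%:M - N) *m Z = 0.
  rewrite mulmxBl mul1mx; apply/eqP; rewrite subr_eq0; apply/eqP.
  have ZT : Z *m T = Y *m (S *m Z *m T) by rewrite {1}YE -!mulmxA.
  by rewrite /N ZT mulmxK// -mulmxA -YE.
have : (1%:M - N) *m rho = 0.
  by apply/row_matrixP => i; rewrite row_mul ker ?row0// -row_mul NZ row0.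
rewrite mulmxBl mul1mx => /eqP; rewrite subr_eq0 => /eqP {2}->.
by rewrite /N !mulmxA.
Qed.

Section Subbundles.
Variables (R : realType) (m : nat) (M : manifold R m).

Lemma subbundle_fibre (r : nat) (S : set M) (B : M -> set 'rV[R]_m) x :
  subbundle r S B -> S x ->
  exists2 X : 'M[R]_(r, m), row_free X & B x = [set v | (v <= X)%MS].
Proof.
move=> bB Sx; have [U [X [_ Ux [_ H]]]] := bB x Sx.
by have [fX ->] := H x Sx Ux; exists (\matrix_i X i x).
Qed.

Lemma subbundle0 (r : nat) (S : set M) (B : M -> set 'rV[R]_m) x :
  subbundle r S B -> S x -> B x 0.
Proof. by move=> bB Sx; have [X _ ->] := subbundle_fibre bB Sx; exact: sub0mx. Qed.

Lemma subbundleD (r : nat) (S : set M) (B : M -> set 'rV[R]_m) x u v :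
  subbundle r S B -> S x -> B x u -> B x v -> B x (u + v).
Proof.
by move=> bB Sx; have [X _ ->] := subbundle_fibre bB Sx; exact: addmx_sub.
Qed.

Lemma subbundleB (r : nat) (S : set M) (B : M -> set 'rV[R]_m) x u v :
  subbundle r S B -> S x -> B x u -> B x v -> B x (u - v).
Proof.
move=> bB Sx; have [X _ ->] := subbundle_fibre bB Sx => uX vX.
by apply: addmx_sub => //; rewrite (eqmx_opp v).
Qed.

End Subbundles.

Section AdaptedExtension.
Variables (R : realType) (m : nat) (M : manifold R m).
Variables (dimC dimA rankE rankF rankD : nat) (C A : set M) (E F D : M -> set 'rV[R]_m).
Variables (n : nat) (Q : manifold R n) (q : M -> Q).
Hypothesis subC : submanifold dimC C.
Hypothesis bunE : subbundle rankE C E.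
Hypothesis FE : forall x, C x -> F x = tangent dimC C x `&` E x.
Hypothesis bunF : subbundle rankF C F.
Hypothesis bunD : subbundle rankD C D.
Hypothesis FDE : forall x, C x -> F x `<=` D x /\ D x `<=` E x.
Hypothesis subA : submanifold dimA A.
Hypothesis CA : C `<=` A.
Hypothesis TA : forall x, C x ->
  tangent dimA A x = [set u + v | u in tangent dimC C x & v in D x].
Hypothesis DA : forall x, A x -> D x `<=` tangent dimA A x.
Hypothesis intD : integrable_distribution dimA rankD A D.
Hypothesis leaves : leaf_space dimC rankF C F q.

Lemma tangent_CA x v : C x -> tangent dimC C x v -> tangent dimA A x v.
Proof.
move=> Cx tv; rewrite TA//; exists v => //; exists 0; last by rewrite addr0.
exact: subbundle0 bunD Cx.
Qed.

(** The modular law E /\ (TC + D) = (E /\ TC) + D, with E /\ TC = F inside D. *)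
Lemma tangentA_E x v : C x -> tangent dimA A x v -> E x v -> D x v.
Proof.
move=> Cx; rewrite TA// => -[u tu [d Dd <-]] Ev; have [FD DE] := FDE Cx.
apply: (subbundleD bunD Cx) => //; apply: FD; rewrite FE//; split=> //.
by rewrite -(addrK d u); apply: (subbundleB bunE Cx) => //; exact: DE.
Qed.

Let l := (dimA - rankD)%N.

Let lm (j : 'I_l) : (rankD + j < m)%N.
Proof.
have [Am _] := subA; apply: leq_trans Am.
by have := ltn_ord j; rewrite /l ltn_subRL.
Qed.

(* the functions on A defining the local quotient of A by D *)
Let transverse (c : chart R M m) (j : 'I_l) : M -> R := ccoord c (Ordinal (lm j)).

Let transverse_submersion c p : slice_chart dimA A c -> cdom c p -> C p ->
  (forall x, A x -> cdom c x ->
      D x = [set v | forall i : 'I_m, (rankD <= i)%N ->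
                       pairing v (differential (ccoord c i) x) = 0]) ->
  forall w : 'rV[R]_l, exists2 v, tangent dimC C p v &
     forall j, pairing v (differential (transverse c j) p) = w 0 j.
Proof.
move=> sc cp Cp DE w; have [cc _] := sc; have Ap := CA Cp.
pose W : 'rV[R]_m := \row_i (if (rankD <= i < dimA)%N then
   oapp (fun j : 'I_l => w 0 j) 0 (insub (i - rankD)%N) else 0).
have [v vP] := dual_vector W cc cp.
have : tangent dimA A p v.
  by apply/(tangentP v sc cp Ap) => i ri; rewrite vP mxE ltnNge ri andbF.
rewrite TA// => -[u tu [d Dd uv]]; exists u => // j.
have := vP (Ordinal (lm j)); rewrite -uv pairingDl.
have -> : pairing d (differential (ccoord c (Ordinal (lm j))) p) = 0.
  by move: Dd; rewrite DE// => /(_ (Ordinal (lm j))); apply; rewrite /= leq_addr.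
rewrite addr0 => ->; rewrite mxE /= leq_addr /=.
have -> : (rankD + j < dimA)%N by have := ltn_ord j; rewrite /l ltn_subRL.
rewrite addKn; case: insubP => [j' _ jj'|]; last by rewrite ltn_ord.
by congr (w 0 _); apply/val_inj.
Qed.

(** Near p the distribution D is the kernel of the submersion h from A given by
    the transverse coordinates of a foliated chart. Since TA = TC + D, the
    restriction of h to C is a submersion with kernel TC /\ D = F. In a chart of
    C adapted to h the fibres of this restriction are connected integral
    manifolds of F, so that f o q is constant on them and is a function of h.
    The same function of h, away from C, is the extension f0. *)
Lemma transverse_extension (f : Q -> R) p : smooth setT f -> C p ->
  exists (c : chart R M m) (U : set M) (f0 : M -> R),
    [/\ slice_chart dimA A c /\ U `<=` cdom c, open U /\ U p, smooth U f0,
        forall x, C x -> U x -> f0 x = f (q x) &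
        forall x, A x -> U x -> forall v, D x v -> pairing v (differential f0 x) = 0].
Proof.
move=> Cf Cp; have Ap := CA Cp.
have [c [sc cp DE]] := intD Ap; have [cc cA] := sc; have oc := compatible_open cc.
have [[qs _] _ qleaf] := leaves.
have [Uk [k [oUk Ukp Ck kP]]] := qs p setT f Cp openT I Cf.
pose h := transverse c; pose U1 := cdom c `&` Uk.
have oU1 : open U1 by exact: openI.
have Ch j : smooth (cdom c) (h j) by exact: smooth_ccoord.
have Ch1 j : smooth U1 (h j) by apply: smooth_sub (Ch j) => x [].
have hs := transverse_submersion sc cp Cp DE.
have [x [e [[/andP[lC Cm] e0] [sx xU] [xp xp0] xim xh]]] :=
  submersion_chart subC Cp oU1 (conj cp Ukp) Ch1 hs.
have cx : compatible_chart x by case: sx.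
have ox := compatible_open cx; have [[_ _ xK _ _] _] := cx; have [_ xC] := sx.
pose r := (dimC - l)%N.
have rm : (r <= m)%N by apply: leq_trans (leq_subr _ _) Cm.
have xc y : cdom x y -> cdom c y by move=> /xU[].
have xk y : cdom x y -> Uk y by move=> /xU[].
have rj (j : 'I_l) : (r + j < m)%N.
  apply: leq_trans Cm; rewrite -[X in (_ < X)%N](subnK lC) ltn_add2l.
  exact: ltn_ord.
have dxh y j : cdom x y -> differential (ccoord x (Ordinal (rj j))) y = differential (h j) y.
  move=> xy; have -> : ccoord x (Ordinal (rj j)) = (fun z => h j z - h j p).
    by apply/funext => z; rewrite (xh _ j).
  rewrite (differentialB oc (xc _ xy) (Ch j) (smooth_cst _ oc)).
  by rewrite differential_cst subr0.
have idxC (i : 'I_m) : (r <= i)%N -> (i < dimC)%N -> exists j : 'I_l, i = Ordinal (rj j).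
  move=> ri iC; have il : (i - r < l)%N by rewrite ltn_subLR// subnK.
  by exists (Ordinal il); apply/val_inj; rewrite /= subnKC.
have idxA (i : 'I_m) : (rankD <= i)%N -> (i < dimA)%N -> exists j : 'I_l, i = Ordinal (lm j).
  move=> ri iA; have il : (i - rankD < l)%N by rewrite /l ltn_sub2r// (leq_ltn_trans ri iA).
  by exists (Ordinal il); apply/val_inj; rewrite /= subnKC.
(* in the chart x the distribution F is spanned by the first r coordinates *)
have FxE y : C y -> cdom x y -> F y = [set v | forall i : 'I_m, (r <= i)%N ->
    pairing v (differential (ccoord x i) y) = 0].
  move=> Cy xy; have Ay := CA Cy; have cy := xc y xy.
  apply/seteqP; split=> v.
    move=> Fv i ri; have := Fv; rewrite FE// => -[tv _].
    have [iC|Ci] := ltnP i dimC; last by have [+ _] := tangentP v sx xy Cy; apply.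
    have [j ->] := idxC i ri iC; rewrite dxh//.
    have := (FDE Cy).1 _ Fv; rewrite DE// => /(_ (Ordinal (lm j))); apply.
    by rewrite /= leq_addr.
  move=> vx; have tv : tangent dimC C y v.
    apply/(tangentP v sx xy Cy) => i Ci; apply: vx.
    exact: leq_trans (leq_subr _ _) Ci.
  have Dv : D y v.
    rewrite DE// => i Di; have [iA|Ai] := ltnP i dimA.
      have [j ->] := idxA i Di iA; rewrite -[differential _ _](dxh y j xy).
      by apply: vx; rewrite /= leq_addr.
    by have [+ _] := tangentP v sc cy Ay; apply=> //; exact: tangent_CA.
  by rewrite FE//; split=> //; exact: (FDE Cy).2.
have rF : rankF = r.
  have [X fX XE] := subbundle_fibre bunF Cp.
  apply: (kernel_dimension (chart_jacobian_unit cx xp) fX rm) => v.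
  have -> : (v <= X)%MS <-> F p v by rewrite XE.
  by rewrite FxE//; split=> H i ri; [rewrite rowK; exact: H|have := H i ri; rewrite rowK].
have leafx y z : C y -> cdom x y -> plaque x r y z -> C z /\ q z = q y.
  move=> Cy xy yz.
  have plC : plaque x r y `<=` C.
    move=> w [xw wE]; apply/(xC w xw) => i Ci.
    rewrite wE; first by have [+ _] := xC y xy; apply.
    exact: leq_trans (leq_subr _ _) Ci.
  have Cz := plC _ yz; split=> //; apply/(qleaf z y Cz Cy).
  apply: rt_step; exists (plaque x r y); split=> //.
  rewrite rF; apply: (plaque_integral rm cx xim xy plC) => w yw.
  by apply: FxE; [exact: plC|case: yw].
pose proj y : 'rV[R]_m := \row_i (if (r <= i < dimC)%N then
   oapp (fun j => h j y - h j p) 0 (insub (i - r)%N) else 0).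
have Cproj i : smooth (cdom c) (fun y => proj y 0 i).
  under eq_fun do rewrite mxE; case: (_ && _); last exact: smooth_cst.
  case: insub => [j|] /=; last exact: smooth_cst.
  by apply: smoothB => //; exact: smooth_cst.
have projE y : C y -> cdom x y -> forall i : 'I_m, (r <= i)%N -> proj y 0 i = ccoord x i y.
  move=> Cy xy i ri; rewrite mxE ri /=; case: ltnP => [iC|Ci].
    have [j ->] := idxC i ri iC; rewrite (xh _ j)//= addKn.
    case: insubP => [j' _ jj'|]; last by rewrite ltn_ord.
    by rewrite (_ : j' = j)//; apply/val_inj.
  by have [+ _] := xC y xy; move=> ->.
have obe : open (ball (0 : 'rV[R]_m) e) by exact: ball_open.
pose U := cdom c `&` proj @^-1` ball 0 e `&` cdom x.
have oU : open U by apply: openI => //; exact: smooth_preimage_open.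
have Up : U p.
  split=> //; split=> //; rewrite /= (_ : proj p = 0); first exact: ballxx.
  apply/rowP => i; rewrite !mxE; case: ifP => // _.
  by case: insub => [j|] //=; rewrite subrr.
have Uc : U `<=` cdom c by move=> y [[]].
have Ckx : Cinf (ball 0 e) (k \o cinv x).
  have := smooth_chart cx oUk Ck; rewrite (_ : cdom x `&` Uk = cdom x) ?xim//.
  by apply/setIidl => y /xk.
exists c, U, ((k \o cinv x) \o proj); split=> //.
- apply: (smooth_comp oU obe) => //; first by move=> y [[]].
  by move=> j; exact: smooth_sub (Cproj j).
- move=> y Cy [[cy py] xy] /=.
  have [z xz zE] : (cmap x @` cdom x) (proj y) by rewrite xim.
  rewrite -zE xK//.
  have yz : plaque x r y z by split=> // i ri; rewrite /ccoord zE projE.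
  have [Cz <-] := leafx y z Cy xy yz.
  by have [_ ->] := kP z Cz (xk _ xz).
move=> y Ay Uy v Dv; have [[cy py] xy] := Uy.
rewrite (@differential_comp _ _ _ U _ (ball 0 e) (k \o cinv x) proj y Uy obe py Ckx); last first.
  by move=> j; exact: smooth_sub (Cproj j).
rewrite pairing_sumr big1// => i _; rewrite pairingZr.
rewrite (_ : pairing v _ = 0) ?mulr0//.
under eq_fun do rewrite mxE.
case: (_ && _); last by rewrite differential_cst pairing0r.
case: insub => [j|] /=; last by rewrite differential_cst pairing0r.
rewrite (differentialB oc cy (Ch j) (smooth_cst _ oc)) differential_cst subr0.
by move: Dv; rewrite DE// => /(_ (Ordinal (lm j))); apply; rewrite /= leq_addr.
Qed.

(** The function f0 is made to annihilate E along C by subtracting a combination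
    of the slice functions y_j of A, which changes neither its values on A nor
    its derivatives along D. The coefficients b must satisfy Z b = rho on C, where
    Z and rho are the derivatives of the y_j and of f0 along a frame of E. The
    left null vectors of Z represent E /\ TA = D: hence they annihilate rho, and
    Z has constant rank on C. *)
Theorem adapted_extension_exists (f : Q -> R) p : smooth setT f -> C p ->
  exists (U : set M) (h : M -> R),
    [/\ open U, U p & adapted_extension C A E D (f \o q) U h].
Proof.
move=> Cf Cp.
have [c [U0 [f0 [[sc U0c] [oU0 U0p] Cf0 f0C f0D]]]] := transverse_extension Cf Cp.
have [cc cA] := sc; have oc := compatible_open cc.
have [U1 [X [oU1 U1p [CX XE]]]] := bunE Cp.
pose U := U0 `&` U1; have oU : open U by exact: openI.
have UU0 : U `<=` U0 by move=> x [].
have UU1 : U `<=` U1 by move=> x [].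
have Uc : U `<=` cdom c by move=> x /UU0 /U0c.
(* normal coordinates of A, extended by zero to all indices *)
pose y (j : 'I_m) : M -> R := if (dimA <= j)%N then ccoord c j else fun=> 0.
have Cy j : smooth U (y j).
  rewrite /y; case: ifP => _; last exact: smooth_cst.
  exact: smooth_sub (smooth_ccoord j cc).
have yA j x : A x -> U x -> y j x = 0.
  move=> Ax Ux; rewrite /y; case: leqP => // Aj.
  by have [+ _] := cA x (Uc x Ux); apply.
have dyT j x v : A x -> U x -> tangent dimA A x v -> pairing v (differential (y j) x) = 0.
  move=> Ax Ux tv; apply: (tangent_annihilates tv Ax oU Ux (Cy j)) => z Az Uz.
  exact: yA.
pose Z x : 'M[R]_(rankE, m) := \matrix_(a, j) vf_act (X a) (y j) x.
pose rho x : 'cV[R]_rankE := \col_a vf_act (X a) f0 x.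
have CZ i j : smooth U (fun x => Z x i j).
  by under eq_fun do rewrite mxE; exact: (smooth_vf_sub UU1 (CX i)) (Cy j).
have Crho i j : smooth U (fun x => rho x i j).
  under eq_fun do rewrite mxE; apply: (smooth_vf_sub UU1 (CX i)) => //.
  exact: smooth_sub Cf0.
pose Xm x := \matrix_a X a x.
have aX x (a : 'rV[R]_rankE) : a *m Xm x = \sum_i a 0 i *: X i x.
  by rewrite mulmx_sum_row; apply: eq_bigr => i _; rewrite rowK.
have aZ x (a : 'rV[R]_rankE) j : (a *m Z x) 0 j = pairing (a *m Xm x) (differential (y j) x).
  rewrite aX pairing_suml mxE; apply: eq_bigr => i _.
  by rewrite mxE pairingZl.
have arho x (a : 'rV[R]_rankE) : (a *m rho x) 0 0 = pairing (a *m Xm x) (differential f0 x).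
  rewrite aX pairing_suml mxE; apply: eq_bigr => i _.
  by rewrite mxE pairingZl.
have XD x (a : 'rV[R]_rankE) : C x -> U x -> a *m Z x = 0 <-> D x (a *m Xm x).
  move=> Cx Ux; have Ax := CA Cx; have [_ EX] := XE x Cx (UU1 _ Ux).
  have Ea : E x (a *m Xm x) by rewrite EX /= submxMl.
  split=> [aZ0|Da].
    apply: (tangentA_E Cx) => //; apply/(tangentP _ sc (Uc _ Ux) Ax) => i Ai.
    have := aZ x a i; rewrite aZ0 mxE => /esym.
    by rewrite /y Ai.
  apply/rowP => j; rewrite aZ mxE; apply: dyT => //.
  exact: (DA Ax).
(* the left kernel of Z x has the dimension of D x *)
have rkZ x : C x -> U x -> \rank (Z x) = (rankE - rankD)%N.
  move=> Cx Ux; have [fX EX] := XE x Cx (UU1 _ Ux).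
  have [Y fY DY] := subbundle_fibre bunD Cx.
  have kerD : \rank (kermx (Z x)) = rankD.
    rewrite -(mxrankMfree (kermx (Z x)) fX) -/(Xm x) -(eqP fY).
    apply/eqmx_rank/andP; split; apply/row_subP => i.
      have : D x (row i (kermx (Z x)) *m Xm x).
        by apply/XD => //; rewrite -row_mul mulmx_ker row0.
      by rewrite DY /= [X in _ -> (X <= _)%MS]row_mul.
    have Di : D x (row i Y) by rewrite DY /= row_sub.
    have := (FDE Cx).2 _ Di; rewrite EX /= => /submxP[a aE].
    rewrite aE submxMr//; apply/sub_kermxP.
    by apply/XD => //; rewrite -/(Xm x) in aE; rewrite -aE.
  have := mxrank_ker (Z x); rewrite kerD => ->.
  by rewrite subKn// rank_leq_row.
have Up : U p by [].
(* S and T are one-sided inverses of the factors of Z p, so that S Z T is the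
   identity at p and invertible nearby *)
pose k := \rank (Z p).
pose S : 'M[R]_(k, rankE) := pinvmx (col_base (Z p)).
pose T : 'M[R]_(m, k) := pinvmx (row_base (Z p)).
pose K x := S *m Z x *m T.
have CcK (a b : nat) (N : 'M[R]_(a, b)) i j : smooth U (fun=> N i j) by exact: smooth_cst.
have CK : forall i j, smooth U (fun x => K x i j).
  by apply: smooth_mulmx => //; exact: smooth_mulmx.
have Kp : K p \in unitmx.
  have SZ : S *m col_base (Z p) = 1%:M by rewrite mulVpmx ?col_base_full.
  have ZT : row_base (Z p) *m T = 1%:M by rewrite mulmxVp ?row_base_free.
  have -> : K p = S *m col_base (Z p) *m (row_base (Z p) *m T).
    by rewrite mulmxA -(mulmxA S) mulmx_base.
  by rewrite SZ ZT mul1mx unitmx1.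
pose W := U `&` [set x | K x \in unitmx].
have oW : open W by exact: smooth_unit_open.
have WU : W `<=` U by move=> x [].
pose b x : 'cV[R]_m := T *m invmx (K x) *m (S *m rho x).
have Cb j : smooth W (fun x => b x j 0).
  have CW (a' b' : nat) (N : M -> 'M[R]_(a', b')) :
    (forall i j, smooth U (fun x => N x i j)) -> forall i j, smooth W (fun x => N x i j).
    by move=> CN i j'; exact: smooth_sub (CN i j').
  apply: smooth_mulmx => //; apply: smooth_mulmx => //.
  - by move=> i j'; exact: smooth_cst.
  - have uK x : W x -> K x \in unitmx by case.
    by move=> i j'; exact: (smooth_invmx i j' oW uK (CW _ _ K CK)).
  - by move=> i j'; exact: smooth_cst.
  - exact: CW.
have CyW j := smooth_sub WU (Cy j).
have Cf0W : smooth W f0 by apply: smooth_sub Cf0 => x [[]].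
have Cyb j : smooth W (fun x => y j x * b x j 0) by exact: smoothM.
pose h x := f0 x - \sum_j y j x * b x j 0.
have Csum : smooth W (fun x => \sum_j y j x * b x j 0).
  by apply: (@smooth_sum _ _ _ _ _ _ _ (fun j x => y j x * b x j 0)).
have dh x : A x -> W x ->
    differential h x = differential f0 x - \sum_j b x j 0 *: differential (y j) x.
  move=> Ax Wx; rewrite (differentialB oW Wx Cf0W Csum); congr (_ - _).
  rewrite (differential_sum _ oW Wx Cyb); apply: eq_bigr => j _.
  by rewrite (differentialM Wx (CyW j) (Cb j)) yA ?scale0r ?add0r//; exact: WU.
exists W, h; split=> //; split.
- exact: smoothB.
- move=> x Cx Wx; rewrite /h big1 ?subr0 ?f0C//; first by case: Wx => -[].
  by move=> j _; rewrite yA ?mul0r//; [exact: CA|exact: WU].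
- move=> x Cx Wx v Ev; have Ax := CA Cx; have Ux := WU _ Wx.
  rewrite dh// pairingBr pairing_sumr.
  have [_ EX] := XE x Cx (UU1 _ Ux).
  move: Ev; rewrite EX /= -/(Xm x) => /submxP[a ->].
  have -> : pairing (a *m Xm x) (differential f0 x) = (a *m Z x *m b x) 0 0.
    have rk : \rank (Z x) = k by rewrite /k !rkZ.
    have uK : S *m Z x *m T \in unitmx by case: Wx.
    have ker (a' : 'rV_rankE) : a' *m Z x = 0 -> a' *m rho x = 0.
      move=> /XD => /(_ Cx Ux) Da'; apply/matrixP => i j; rewrite (ord1 i) (ord1 j).
      by rewrite arho mxE; apply: f0D => //; case: Ux.
    by rewrite -mulmxA (constant_rank_solution rk uK ker) arho.
  rewrite mxE -sumrB big1// => j _.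
  by rewrite pairingZr aZ mulrC subrr.
- move=> x Ax Wx v Dv; have Ux := WU _ Wx.
  rewrite dh// pairingBr pairing_sumr f0D//; last by case: Ux.
  rewrite big1 ?subr0// => j _; rewrite pairingZr dyT ?mulr0//.
  exact: (DA Ax).
Qed.

End AdaptedExtension.

(** * The Poisson bracket of M *)

Section Bracket.
Variables (R : realType) (m : nat) (M : manifold R m) (Pi : M -> 'M[R]_m).
Implicit Types (f g h : M -> R) (U W : set M) (p : M) (X : M -> 'rV[R]_m).
Hypothesis poissonPi : poisson_bivector Pi.

Definition hamiltonian f : M -> 'rV[R]_m := fun p => sharp Pi p (differential f p).

Lemma pbracketE f g : pbracket Pi f g = vf_act (hamiltonian f) g.
Proof. by []. Qed.

Lemma smooth_pbracket U f g : open U -> smooth U f -> smooth U g ->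
  smooth U (pbracket Pi f g).
Proof. by have [[_ H] _] := poissonPi; exact: H. Qed.

Lemma smooth_hamiltonian U f : smooth U f -> smooth_vf U (hamiltonian f).
Proof.
move=> Cf W g oW WU Cg; rewrite -pbracketE; apply: smooth_pbracket => //.
exact: smooth_sub Cf.
Qed.

Lemma pbracketC f g x : pbracket Pi f g x = - pbracket Pi g f x.
Proof.
have [[anti _] _] := poissonPi; rewrite /pbracket /pairing /sharp.
set a := differential f x; set b := differential g x.
have -> : (a *m Pi x *m b^T) 0 0 = (a *m Pi x *m b^T)^T 0 0 by rewrite [RHS]mxE.
by rewrite !trmx_mul trmxK anti mulNmx mulmxN mulmxA mxE.
Qed.

Lemma pbracket_fun f g : pbracket Pi f g = (fun x => - pbracket Pi g f x).
Proof. by apply/funext => x; exact: pbracketC. Qed.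

Lemma vf_actN U X f p : U p -> smooth U f -> vf_act X (fun x => - f x) p = - vf_act X f p.
Proof. by move=> Up Cf; rewrite /vf_act (differentialN Up Cf) pairingNr. Qed.

(* a composite of derivations, corrected to first order by a third one *)
Let first_order U X X' Y f p : open U -> U p -> smooth_vf U X -> smooth_vf U X' ->
  smooth U f ->
  vf_act X (vf_act X' f) p - vf_act X' (vf_act X f) p - vf_act Y f p =
  \sum_i differential f p 0 i *
    (vf_act X (vf_act X' (mcoord p i)) p - vf_act X' (vf_act X (mcoord p i)) p
     - vf_act Y (mcoord p i) p).
Proof.
move=> oU Up CX CX' Cf.
apply: etrans (congr1 (fun t => t - vf_act Y f p)
  (commutator_derivation oU Up CX CX' Cf)) _.
rewrite [vf_act Y f p]vf_actE -[LHS]sumrB.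
by apply: eq_bigr => i _; rewrite vf_act_mcoord [Y p 0 i * _]mulrC [RHS]mulrBr.
Qed.

Definition jacobiator f g h p := pbracket Pi f (pbracket Pi g h) p +
  pbracket Pi g (pbracket Pi h f) p + pbracket Pi h (pbracket Pi f g) p.

Lemma jacobiator_cycle f g h p : jacobiator f g h p = jacobiator g h f p.
Proof. by rewrite /jacobiator -[LHS]addrA [LHS]addrC. Qed.

(* a commutator of derivations minus a derivation, all applied to f *)
Let jacobiatorE U f g h p : open U -> U p -> smooth U f -> smooth U g -> smooth U h ->
  jacobiator f g h p =
  vf_act (hamiltonian g) (vf_act (hamiltonian h) f) p
  - vf_act (hamiltonian h) (vf_act (hamiltonian g) f) p
  - vf_act (hamiltonian (pbracket Pi g h)) f p.
Proof.
move=> oU Up Cf Cg Ch; rewrite jacobiator_cycle /jacobiator.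
rewrite (pbracketC f (pbracket Pi g h)) (pbracket_fun f g).
congr (_ + _ - _).
exact: (vf_actN _ Up (smooth_pbracket oU Cg Cf)).
Qed.

Let mcoord_smooth U p i : smooth (U `&` cdom (chart_at p)) (mcoord p i).
Proof. by apply: smooth_sub (smooth_ccoord i (compatible_chart_at p)) => x []. Qed.

Lemma jacobiator_derivation U f g h p : open U -> U p ->
  smooth U f -> smooth U g -> smooth U h ->
  jacobiator f g h p = \sum_i differential f p 0 i * jacobiator (mcoord p i) g h p.
Proof.
move=> oU Up Cf Cg Ch; have oc := compatible_open (compatible_chart_at p).
have oW : open (U `&` cdom (chart_at p)) by exact: openI.
have Wp : (U `&` cdom (chart_at p)) p by split=> //; exact: mem_chart_at.
have WU : U `&` cdom (chart_at p) `<=` U by move=> x [].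
rewrite (jacobiatorE oU Up Cf Cg Ch).
rewrite (first_order _ oU Up (smooth_hamiltonian Cg) (smooth_hamiltonian Ch) Cf).
apply: eq_bigr => i _; congr (_ * _).
by rewrite (jacobiatorE oW Wp) //; [exact: smooth_sub Cg|exact: smooth_sub Ch].
Qed.

(** The jacobiator is a derivation in each argument, so it is determined by its
    values on coordinate functions; twice these are the components of the
    Schouten bracket of Pi with itself. *)
Theorem pbracket_jacobi U f g h p : open U -> U p ->
  smooth U f -> smooth U g -> smooth U h -> jacobiator f g h p = 0.
Proof.
move=> oU Up Cf Cg Ch; have oc := compatible_open (compatible_chart_at p).
pose W := U `&` cdom (chart_at p).
have oW : open W by exact: openI.
have Wp : W p by split=> //; exact: mem_chart_at.
have WU : W `<=` U by move=> x [].
have Cx i : smooth W (mcoord p i) := mcoord_smooth U p i.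
have CfW := smooth_sub WU Cf; have CgW := smooth_sub WU Cg; have ChW := smooth_sub WU Ch.
rewrite (jacobiator_derivation oW Wp CfW CgW ChW) big1// => i _.
rewrite jacobiator_cycle (jacobiator_derivation oW Wp CgW ChW (Cx i)) big1 ?mulr0// => j _.
rewrite jacobiator_cycle (jacobiator_derivation oW Wp ChW (Cx i) (Cx j)) big1 ?mulr0// => k _.
have [_ sch] := poissonPi; have := sch p k i j; rewrite /schouten.
have twice (a b c : R) : a + a + (b + b) + (c + c) = (a + b + c) *+ 2 by ring.
rewrite twice => /eqP; rewrite mulrn_eq0 /= => /eqP J0.
by rewrite /jacobiator J0 mulr0.
Qed.

Let lie_defect X f g p := vf_act X (pbracket Pi f g) p
  - pbracket Pi (vf_act X f) g p - pbracket Pi f (vf_act X g) p.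

Let lie_defectC U X f g p : open U -> U p -> smooth_vf U X -> smooth U f -> smooth U g ->
  lie_defect X f g p = - lie_defect X g f p.
Proof.
move=> oU Up CX Cf Cg; rewrite /lie_defect (pbracket_fun f g).
rewrite (vf_actN _ Up (smooth_pbracket oU Cg Cf)).
rewrite (pbracketC (vf_act X f) g p) (pbracketC f (vf_act X g) p).
by rewrite !opprD !opprK addrAC.
Qed.

Let lie_defect_derivation U X f g p : open U -> U p -> smooth_vf U X ->
  smooth U f -> smooth U g ->
  lie_defect X f g p = \sum_i differential g p 0 i * lie_defect X f (mcoord p i) p.
Proof.
move=> oU Up CX Cf Cg; rewrite /lie_defect addrAC.
rewrite (first_order (hamiltonian (vf_act X f)) oU Up CX (smooth_hamiltonian Cf) Cg).
by apply: eq_bigr => i _; rewrite addrAC.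
Qed.

(** The failure of the derivation X to preserve the bracket is a derivation in
    both arguments, by [commutator_derivation]; its components are those of
    L_X Pi by definition. *)
Lemma lie_derivativeP U X f g p : open U -> U p -> smooth_vf U X ->
  smooth U f -> smooth U g ->
  vf_act X (pbracket Pi f g) p
  - pbracket Pi (vf_act X f) g p - pbracket Pi f (vf_act X g) p =
  pairing (differential f p *m lie_derivative X Pi p) (differential g p).
Proof.
move=> oU Up CX Cf Cg; have oc := compatible_open (compatible_chart_at p).
pose W := U `&` cdom (chart_at p).
have oW : open W by exact: openI.
have Wp : W p by split=> //; exact: mem_chart_at.
have WU : W `<=` U by move=> x [].
have Cx i : smooth W (mcoord p i) := mcoord_smooth U p i.
have CfW := smooth_sub WU Cf; have CgW := smooth_sub WU Cg.
have CXW := smooth_vf_sub WU CX.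
rewrite -/(lie_defect X f g p) (lie_defect_derivation oW Wp CXW CfW CgW) pairingE.
apply: eq_bigr => j _; rewrite mulrC; congr (_ * _).
rewrite (lie_defectC oW Wp CXW CfW (Cx j)).
rewrite (lie_defect_derivation oW Wp CXW (Cx j) CfW) -sumrN mxE.
apply: eq_bigr => i _; rewrite -mulrN -(lie_defectC oW Wp CXW (Cx i) (Cx j)).
by congr (_ * _); rewrite [RHS]mxE.
Qed.

Lemma pbracketDZl U a f g h p : open U -> U p -> smooth U f -> smooth U g ->
  pbracket Pi (fun x => a * f x + g x) h p = a * pbracket Pi f h p + pbracket Pi g h p.
Proof.
move=> oU Up Cf Cg; rewrite /pbracket /sharp.
rewrite (differentialD Up (smoothZ a oU Cf) Cg) (differentialZ _ Up Cf).
by rewrite mulmxDl -scalemxAl pairingDl pairingZl.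
Qed.

Lemma pbracketMr U f g h p : U p -> smooth U g -> smooth U h ->
  pbracket Pi f (fun x => g x * h x) p =
  pbracket Pi f g p * h p + g p * pbracket Pi f h p.
Proof.
move=> Up Cg Ch; rewrite /pbracket (differentialM Up Cg Ch) pairingDr !pairingZr.
by rewrite addrC mulrC.
Qed.

End Bracket.

(** * Functions on the quotient *)

(** The submersion q has smooth local sections, namely coordinate slices of a
    chart of S that contains the coordinates of Q pulled back by q. Near q p, the
    function g is u composed with such a section. *)
Lemma smooth_descent (R : realType) (m n k : nat) (M : manifold R m)
    (Q : manifold R n) (S : set M) (q : M -> Q) (g : Q -> R) :
  submanifold k S -> submersion k S q -> q @` S = setT ->
  (forall p, S p -> exists (U : set M) (u : M -> R),
     [/\ open U, U p, smooth U u & forall x, S x -> U x -> g (q x) = u x]) ->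
  smooth setT g.
Proof.
move=> subS [qs qd] qsurj gP; apply: smooth_local => y _.
have [p Sp qp] : (q @` S) y by rewrite qsurj.
subst y; set d := chart_at (q p).
have cd : compatible_chart d := compatible_chart_at (q p).
have odom := compatible_open cd; have dq : cdom d (q p) := mem_chart_at (q p).
have [[_ _ dK dcont _] _] := cd.
have [U0 [u [oU0 U0p Cu guE]]] := gP p Sp.
have /choice[V /choice[h hP]] : forall j : 'I_n, exists (U : set M) (h : M -> R),
    [/\ open U, U p, smooth U h & forall x, S x -> U x ->
        cdom d (q x) /\ h x = mcoord (q p) j (q x)].
  by move=> j; exact: (qs p (cdom d) (mcoord (q p) j) Sp odom dq (smooth_ccoord j cd)).
have [U1 [h1 [oU1 U1p _ h1P]]] :=
  qs p (cdom d) (fun=> 0) Sp odom dq (smooth_cst 0 odom).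
pose U := (U0 `&` U1 `&` [set x | forall j, V j x])°.
have oU : open U by exact: open_interior.
have Up : U p.
  apply: filterI; first by apply: open_nbhs_nbhs; split=> //; exact: openI.
  apply: filter_forall => j; have [oV Vp _ _] := hP j; exact: open_nbhs_nbhs.
have UU x : U x -> [/\ U0 x, U1 x & forall j, V j x].
  by move=> /interior_subset [[]].
have Ch j : smooth U (h j).
  by have [_ _ Ch _] := hP j; apply: smooth_sub Ch => x /UU[].
have hsurj (w : 'rV[R]_n) : exists2 v, tangent k S p v &
    forall j, pairing v (differential (h j) p) = w 0 j.
  have [v tv dv] := qd p Sp w; exists v => // j.
  have [oV Vp CV VP] := hP j.
  rewrite (dv _ _ _ _ odom dq (smooth_ccoord j cd) oV Vp CV VP).
  by rewrite -[ccoord _ _]/(mcoord (q p) j) differential_mcoord pairing_delta.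
have [x [e [[/andP[nk km] e0] [[cx xS] xU] [xp xp0] xim xh]]] :=
  submersion_chart subS Sp oU Up Ch hsurj.
have [[_ _ xK _ _] _] := cx.
pose r := (k - n)%N; pose z0 := cmap d (q p).
pose iota (z : 'rV[R]_n) : 'rV[R]_m := \row_i (if (r <= i < k)%N then
  oapp (fun j => (z - z0) 0 j) 0 (insub (i - r)%N) else 0).
have iotaB z : ball z0 e z -> ball 0 e (iota z).
  move=> [_ zb]; split=> // a i; rewrite (ord1 a) !mxE.
  have b0 : ball (0 : R) e 0 by exact: ballxx.
  case: (_ && _) => //; case: insub => [j|] //=.
  have := zb 0 j; rewrite /ball /= !mxE sub0r normrN distrC.
  by [].
have rj (j : 'I_n) : (r + j < k)%N.
  by rewrite -[X in (_ < X)%N](subnK nk) ltn_add2l ltn_ord.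
have iotaE z (j : 'I_n) (i : 'I_m) : i = (r + j)%N :> nat -> iota z 0 i = (z - z0) 0 j.
  move=> ij; rewrite mxE ij leq_addr rj /= addKn.
  by case: insubP => [j' _ /val_inj->|] //; rewrite ltn_ord.
have iotaS z (i : 'I_m) : (k <= i)%N -> iota z 0 i = 0.
  by move=> ki; rewrite mxE ltnNge ki andbF.
have sect z : ball z0 e z -> [/\ S (cinv x (iota z)), cdom x (cinv x (iota z)) &
     q (cinv x (iota z)) = cinv d z].
  move=> /iotaB; rewrite -xim => -[w xw wE]; rewrite -wE xK//.
  have Sw : S w by apply/(xS w xw) => i ki; rewrite /ccoord wE iotaS.
  split=> //; have [_ U1w Vw] := UU w (xU _ xw).
  have [dw _] := h1P w Sw U1w.
  rewrite -(dK (q w) dw); congr (cinv d _); apply/rowP => j.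
  have [_ Vp _ VP] := hP j.
  have [_ hw] := VP w Sw (Vw j); have [_ hp] := VP p Sp Vp.
  have jm : (r + j < m)%N by apply: leq_trans (rj j) km.
  have := xh (Ordinal jm) j erefl w; rewrite /ccoord wE (iotaE z j)//.
  rewrite hw hp /mcoord /ccoord -/d !mxE => /eqP.
  by rewrite -subr_eq0 opprB addrA subrK subr_eq0 => /eqP ->.
have oB : open (ball z0 e) by exact: ball_open.
have obe : open (ball (0 : 'rV[R]_m) e) by exact: ball_open.
have Cux : Cinf (ball 0 e) (u \o cinv x).
  have := smooth_chart cx oU0 Cu; rewrite (_ : cdom x `&` U0 = cdom x) ?xim//.
  by apply/setIidl => w /xU /UU[].
have Cg : Cinf (ball z0 e) (g \o cinv d).
  move=> k'; apply: (@Ck_ext _ _ _ _ ((u \o cinv x) \o iota)) => //.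
    move=> z /sect[Sz xz E] /=; rewrite -E guE//.
    by have [] := UU _ (xU _ xz).
  apply: (@Ck_comp _ _ _ _ _ (ball 0 e)) => // i.
  under eq_fun do rewrite mxE.
  case: (_ && _); last exact: Ck_cst.
  case: insub => [j|] /=; last exact: Ck_cst.
  under eq_fun do rewrite !mxE.
  by apply: CkD => //; [exact: Ck_coord|exact: Ck_cst].
pose W := cdom d `&` cmap d @^-1` ball z0 e.
exists W; first by split=> //; exact: ballxx.
apply: (chart_smooth cd).
- by apply: smooth_preimage_open => // j; exact: smooth_ccoord.
- by move=> w [].
by move=> k'; apply: Ck_sub (Cg k') => _ [w [_ bw] <-].
Qed.

(** * Reduction *)

Section Reduction.
Variables (R : realType) (m : nat) (M : manifold R m) (Pi : M -> 'M[R]_m).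
Variables (dimC dimA rankF rankD : nat) (C A : set M) (E F D : M -> set 'rV[R]_m).
Variables (n : nat) (Q : manifold R n) (q : M -> Q).
Hypothesis poissonPi : poisson_bivector Pi.
Hypothesis subC : submanifold dimC C.
Hypothesis FDE : forall x, C x -> F x `<=` D x /\ D x `<=` E x.
Hypothesis sharpE : forall x, C x -> forall alpha : 'rV[R]_m,
  (forall v, E x v -> pairing v alpha = 0) ->
  [set u + v | u in tangent dimC C x & v in D x] (sharp Pi x alpha).
Hypothesis CA : C `<=` A.
Hypothesis TA : forall x, C x ->
  tangent dimA A x = [set u + v | u in tangent dimC C x & v in D x].
Hypothesis frames : forall p, C p -> exists (U : set M) (X : 'I_rankD -> M -> 'rV[R]_m),
  [/\ open U, U p, local_frame A D U X &
      forall i x, C x -> U x -> wedge_tangent (E x) (lie_derivative (X i) Pi x)].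
Hypothesis leaves : leaf_space dimC rankF C F q.
Hypothesis extP : forall (f : Q -> R) (p : M), smooth setT f -> C p ->
  exists (U : set M) (h : M -> R),
    [/\ open U, U p & adapted_extension C A E D (f \o q) U h].

Implicit Types (f g : Q -> R) (U W : set M) (phi : M -> R) (u : M -> R).

Notation adapted := (adapted_extension C A E D).

Lemma adapted_sub u U W phi : W `<=` U -> adapted u U phi -> adapted u W phi.
Proof.
move=> WU [C1 C2 C3 C4]; split.
- exact: smooth_sub C1.
- by move=> x Cx /WU; exact: C2.
- by move=> x Cx /WU; exact: C3.
- by move=> x Ax /WU; exact: C4.
Qed.

(** The Hamiltonian vector of an adapted extension lies in TC + D, so the
    bracket with it only sees the restriction of phi to C and its derivative
    along D. *)
Lemma adapted_bracket0 u U W h phi x : adapted u U h -> C x -> U x ->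
  open W -> W x -> smooth W phi -> (forall y, C y -> W y -> phi y = 0) ->
  (forall v, D x v -> pairing v (differential phi x) = 0) ->
  pbracket Pi h phi x = 0.
Proof.
move=> [_ _ hE _] Cx Ux oW Wx Cphi phi0 phiD.
have [t tt [v Dv tv]] := sharpE Cx (hE x Cx Ux).
rewrite /pbracket -tv pairingDl (phiD v Dv) addr0.
exact: tangent_annihilates tt Cx oW Wx Cphi phi0.
Qed.

Lemma adapted_bracket_eq u u' U W h phi phi' x : adapted u U h -> C x -> U x ->
  open W -> W x -> adapted u' W phi -> adapted u' W phi' ->
  pbracket Pi h phi x = pbracket Pi h phi' x.
Proof.
move=> ah Cx Ux oW Wx [C1 e1 _ d1] [C2 e2 _ d2].
apply/eqP; rewrite -subr_eq0 /pbracket -pairingBr.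
rewrite -(differentialB oW Wx C1 C2); apply/eqP.
apply: (adapted_bracket0 (u := u) (U := U) (W := W)) => //.
- exact: smoothB.
- by move=> y Cy Wy; rewrite e1// e2// subrr.
move=> v Dv; rewrite (differentialB oW Wx C1 C2) pairingBr.
by rewrite d1 ?d2 ?subrr//; exact: CA.
Qed.

Lemma adapted_bracket_unique f g U1 U2 h1 h2 k1 k2 x :
  C x -> open U1 -> U1 x -> open U2 -> U2 x ->
  adapted (f \o q) U1 h1 -> adapted (g \o q) U1 k1 ->
  adapted (f \o q) U2 h2 -> adapted (g \o q) U2 k2 ->
  pbracket Pi h1 k1 x = pbracket Pi h2 k2 x.
Proof.
move=> Cx oU1 U1x oU2 U2x ah1 ak1 ah2 ak2.
have oW : open (U1 `&` U2) by exact: openI.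
have s1 : U1 `&` U2 `<=` U1 by move=> y [].
have s2 : U1 `&` U2 `<=` U2 by move=> y [].
rewrite (adapted_bracket_eq ah1 Cx U1x oW (conj U1x U2x) (adapted_sub s1 ak1) (adapted_sub s2 ak2)).
rewrite (pbracketC poissonPi h1) (pbracketC poissonPi h2); congr (- _).
exact: (adapted_bracket_eq ak2 Cx U2x oW (conj U1x U2x) (adapted_sub s1 ah1) (adapted_sub s2 ah2)).
Qed.

(** For a frame field X of D, the derivative X {h, k} is the sum of
    (L_X Pi)(dh, dk), {X h, k} and {h, X k}. The first term vanishes because L_X Pi
    lies in the wedge of E and TM and both dh and dk annihilate E. The other two
    vanish because X h and X k are zero on A, while the Hamiltonian vectors of
    k and h lie in TC + D = TA. *)
Lemma adapted_bracket_invariant u w U h k x v : open U -> C x -> U x ->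
  adapted u U h -> adapted w U k -> D x v ->
  pairing v (differential (pbracket Pi h k) x) = 0.
Proof.
move=> oU Cx Ux ah ak Dv; have Ax := CA Cx.
have [U1 [X [oU1 U1x [CX XD] LX]]] := frames Cx.
pose W := U `&` U1; have oW : open W by exact: openI.
have Wx : W x by [].
have WU : W `<=` U by move=> y [].
have WU1 : W `<=` U1 by move=> y [].
have [_ DE] := XD x Ax U1x.
move: Dv; rewrite DE /= => /submxP[a ->]; rewrite mulmx_sum_row pairing_suml.
apply: big1 => i _; rewrite rowK pairingZl.
rewrite -/(vf_act (X i) _ x) (_ : vf_act _ _ _ = 0) ?mulr0//.
have CXW := smooth_vf_sub WU1 (CX i).
have [Ch _ hE hD] := ah; have [Ck _ kE kD] := ak.
have ChW := smooth_sub WU Ch; have CkW := smooth_sub WU Ck.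
(* the Hamiltonian vectors of adapted extensions are tangent to A along C, so
   they kill functions vanishing on A *)
have tangentA u0 phi psi : adapted u0 U phi ->
    smooth W psi -> (forall y, A y -> W y -> vf_act (X i) psi y = 0) ->
    pbracket Pi phi (vf_act (X i) psi) x = 0.
  move=> [_ _ phiE _] Cpsi psi0.
  have tA : tangent dimA A x (sharp Pi x (differential phi x)).
    by rewrite TA//; apply: sharpE => //; exact: phiE.
  exact: (tangent_annihilates tA Ax oW Wx (CXW _ _ oW (@subset_refl _ _) Cpsi) psi0).
have X0 phi : (forall y, A y -> U y -> forall v, D y v -> pairing v (differential phi y) = 0) ->
    forall y, A y -> W y -> vf_act (X i) phi y = 0.
  move=> phiD y Ay Wy; apply: phiD => //; first exact: WU.
  have [_ ->] := XD y Ay (WU1 _ Wy).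
  by rewrite /= -[X i y](rowK (fun i => X i y)) row_sub.
have := lie_derivativeP poissonPi oW Wx CXW ChW CkW.
rewrite (pbracketC poissonPi (vf_act (X i) h)).
rewrite (tangentA w k h ak ChW (X0 h hD)) (tangentA u h k ah CkW (X0 k kD)).
rewrite !oppr0 !addr0 => ->.
have [l [e [e' [eE ->]]]] := LX i x Cx U1x.
have e_kills phi : (forall v, E x v -> pairing v (differential phi x) = 0) ->
    e *m (differential phi x)^T = 0.
  move=> phiE; apply/matrixP => a' b; rewrite (ord1 b) [RHS]mxE -(phiE _ (eE a')).
  by rewrite /pairing -row_mul [RHS]mxE.
rewrite /pairing mulmxBr mulmxBl.
have he : differential h x *m e^T = 0.
  by apply: trmx_inj; rewrite trmx_mul trmxK e_kills ?trmx0//; exact: hE.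
rewrite mulmxA he mul0mx mul0mx sub0r !mulmxA -(mulmxA _ e) e_kills ?mulmx0 ?oppr0 ?mxE//.
exact: kE.
Qed.

(** The brackets of local adapted extensions glue to a function on C, which is
    constant along the leaves because its derivatives along F vanish. *)
Lemma reduced_bracket_exists f g : smooth setT f -> smooth setT g ->
  exists br : Q -> R, forall U h k x, open U -> C x -> U x ->
    adapted (f \o q) U h -> adapted (g \o q) U k -> br (q x) = pbracket Pi h k x.
Proof.
move=> Cf Cg.
have local p : C p -> exists U h k,
    [/\ open U, U p, adapted (f \o q) U h & adapted (g \o q) U k].
  move=> Cp; have [U [h [oU Up ah]]] := extP Cf Cp.
  have [V [k [oV Vp ak]]] := extP Cg Cp.
  exists (U `&` V), h, k; split=> //; first exact: openI.
    by apply: adapted_sub ah => y [].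
  by apply: adapted_sub ak => y [].
have /choice[b bP] p : exists t : R, C p -> forall U h k, open U -> U p ->
    adapted (f \o q) U h -> adapted (g \o q) U k -> t = pbracket Pi h k p.
  have [Cp|nCp] := pselect (C p); last by exists 0.
  have [U [h [k [oU Up ah ak]]]] := local p Cp.
  exists (pbracket Pi h k p) => _ U' h' k' oU' U'p ah' ak'.
  exact: (adapted_bracket_unique Cp oU Up oU' U'p ah ak ah' ak').
have [_ qsurj qleaf] := leaves.
have bleaf x y : C x -> C y -> q x = q y -> b x = b y.
  move=> Cx Cy /(qleaf x y Cx Cy); apply: same_leaf_constant => z Cz.
  have [U [h [k [oU Uz ah ak]]]] := local z Cz.
  exists U, (pbracket Pi h k); split=> //.
  - by apply: smooth_pbracket => //; [case: ah|case: ak].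
  - by move=> w Cw Uw; exact: (bP w Cw U h k).
  - move=> w Cw Uw v Fv; apply: (adapted_bracket_invariant oU Cw Uw ah ak).
    exact: (FDE Cw).1.
have /choice[s sP] y : exists x, C x /\ q x = y.
  have [x Cx qx] : (q @` C) y by rewrite qsurj.
  by exists x.
exists (b \o s) => U h k x oU Cx Ux ah ak.
have [Cs qs] := sP (q x).
by rewrite /= (bleaf _ _ Cs Cx qs); exact: (bP x Cx U h k).
Qed.

Lemma adapted_comb (a : R) f g U h k : open U ->
  adapted (f \o q) U h -> adapted (g \o q) U k ->
  adapted ((fun y => a * f y + g y) \o q) U (fun x => a * h x + k x).
Proof.
move=> oU [C1 e1 E1 D1] [C2 e2 E2 D2].
have d x : U x -> differential (fun x => a * h x + k x) x =
    a *: differential h x + differential k x.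
  by move=> Ux; rewrite (differentialD Ux (smoothZ a oU C1) C2) (differentialZ _ Ux C1).
split.
- by apply: smoothD => //; exact: smoothZ.
- by move=> x Cx Ux; rewrite e1// e2.
- by move=> x Cx Ux v Ev; rewrite d// pairingDr pairingZr E1// E2// mulr0 addr0.
- by move=> x Cx Ux v Dv; rewrite d// pairingDr pairingZr D1// D2// mulr0 addr0.
Qed.

Lemma adapted_mul f g U h k : open U ->
  adapted (f \o q) U h -> adapted (g \o q) U k ->
  adapted ((fun y => f y * g y) \o q) U (fun x => h x * k x).
Proof.
move=> oU [C1 e1 E1 D1] [C2 e2 E2 D2].
split.
- exact: smoothM.
- by move=> x Cx Ux; rewrite e1// e2.
- move=> x Cx Ux v Ev; rewrite (differentialM Ux C1 C2) pairingDr !pairingZr.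
  by rewrite E1// E2// !mulr0 addr0.
- move=> x Cx Ux v Dv; rewrite (differentialM Ux C1 C2) pairingDr !pairingZr.
  by rewrite D1// D2// !mulr0 addr0.
Qed.

Lemma common_extensions f g (h : Q -> R) x : smooth setT f -> smooth setT g -> smooth setT h -> C x ->
  exists U (f' g' h' : M -> R), [/\ open U, U x, adapted (f \o q) U f',
    adapted (g \o q) U g' & adapted (h \o q) U h'].
Proof.
move=> Cf Cg Ch Cx.
have [U1 [f' [oU1 U1x af]]] := extP Cf Cx.
have [U2 [g' [oU2 U2x ag]]] := extP Cg Cx.
have [U3 [h' [oU3 U3x ah]]] := extP Ch Cx.
exists (U1 `&` U2 `&` U3), f', g', h'; split.
- by apply: openI => //; exact: openI.
- by [].
- by apply: adapted_sub af => y [[]].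
- by apply: adapted_sub ag => y [[]].
- by apply: adapted_sub ah => y [].
Qed.

(** The Jacobi identity needs an argument: the bracket {g', h'} of adapted
    extensions need not be an adapted extension of the reduced bracket, as it is
    only known to be constant along D, at points of C. Its difference with an
    adapted extension nevertheless satisfies the assumptions of
    [adapted_bracket0], so that both have the same bracket with f'. *)
Theorem reduction : inherits_poisson Pi C A E D q.
Proof.
split; first by move=> f p; exact: extP.
have /choice[br' br'P] : forall fg : (Q -> R) * (Q -> R), exists br : Q -> R,
    smooth setT fg.1 -> smooth setT fg.2 ->
    forall U h k x, open U -> C x -> U x ->
    adapted (fg.1 \o q) U h -> adapted (fg.2 \o q) U k -> br (q x) = pbracket Pi h k x.
  move=> [f g] /=; have [[Cf Cg]|nC] := pselect (smooth setT f /\ smooth setT g).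
    by have [br brP] := reduced_bracket_exists Cf Cg; exists br.
  by exists (fun=> 0) => Cf Cg; case: nC.
pose br f g := br' (f, g).
have brP f g U h k x : smooth setT f -> smooth setT g -> open U -> C x -> U x ->
    adapted (f \o q) U h -> adapted (g \o q) U k -> br f g (q x) = pbracket Pi h k x.
  by move=> Cf Cg; exact: (br'P (f, g) Cf Cg).
exists br; split; last first.
  move=> f g U f' g' Cf Cg oU af ag x Cx Ux; exact: (brP _ _ U).
have [qsub qsurj _] := leaves.
have surj y : exists2 x, C x & q x = y.
  have [x Cx qx] : (q @` C) y by rewrite qsurj.
  by exists x.
have Cbr f g : smooth setT f -> smooth setT g -> smooth setT (br f g).
  move=> Cf Cg; apply: (smooth_descent subC qsub qsurj) => p Cp.
  have [U [f' [g' [_ [oU Up af ag _]]]]] := common_extensions Cf Cg Cg Cp.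
  exists U, (pbracket Pi f' g'); split=> //.
    by apply: smooth_pbracket => //; [case: af|case: ag].
  by move=> x Cx Ux; exact: (brP _ _ U).
split=> //.
- move=> a f g h Cf Cg Ch; apply/funext => y; have [x Cx <-] := surj y.
  have [U [f' [g' [h' [oU Ux af ag ah]]]]] := common_extensions Cf Cg Ch Cx.
  have Cfg : smooth setT (fun x => a * f x + g x).
    by apply: smoothD openT _ _ => //; exact: smoothZ openT _.
  rewrite (brP _ _ U _ _ _ Cfg Ch oU Cx Ux (adapted_comb a oU af ag) ah).
  rewrite (brP _ _ U _ _ _ Cf Ch oU Cx Ux af ah) (brP _ _ U _ _ _ Cg Ch oU Cx Ux ag ah).
  have [Cf1 _ _ _] := af; have [Cg1 _ _ _] := ag.
  exact: (pbracketDZl _ _ _ oU Ux Cf1 Cg1).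
- move=> f g Cf Cg; apply/funext => y; have [x Cx <-] := surj y.
  have [U [f' [g' [_ [oU Ux af ag _]]]]] := common_extensions Cf Cg Cg Cx.
  rewrite (brP _ _ U _ _ _ Cf Cg oU Cx Ux af ag) (brP _ _ U _ _ _ Cg Cf oU Cx Ux ag af).
  exact: pbracketC.
- move=> f g h Cf Cg Ch; apply/funext => y; have [x Cx <-] := surj y.
  have [U [f' [g' [h' [oU Ux af ag ah]]]]] := common_extensions Cf Cg Ch Cx.
  (* an adapted extension of a reduced bracket differs from the bracket of the
     extensions by a function which the Hamiltonian vectors annihilate *)
  have nested (u v w : Q -> R) (u' v' w' : M -> R) : smooth setT u -> smooth setT v -> smooth setT w ->
      adapted (u \o q) U u' -> adapted (v \o q) U v' -> adapted (w \o q) U w' ->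
      br u (br v w) (q x) = pbracket Pi u' (pbracket Pi v' w') x.
    move=> Cu Cv Cw au av aw; have Cvw := Cbr v w Cv Cw.
    have [V [k [oV Vx ak]]] := extP Cvw Cx.
    have oW : open (U `&` V) by exact: openI.
    have Wx : (U `&` V) x by [].
    have WU : U `&` V `<=` U by move=> z [].
    have WV : U `&` V `<=` V by move=> z [].
    have Ck : smooth (U `&` V) k by case: (adapted_sub WV ak).
    have Cv'w' : smooth (U `&` V) (pbracket Pi v' w').
      apply: smooth_pbracket => //; first by case: (adapted_sub WU av).
      by case: (adapted_sub WU aw).
    rewrite (brP _ _ _ _ _ _ Cu Cvw oW Cx Wx (adapted_sub WU au) (adapted_sub WV ak)).
    apply/eqP; rewrite -subr_eq0 /pbracket -pairingBr.
    rewrite -(differentialB oW Wx Ck Cv'w'); apply/eqP.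
    apply: (adapted_bracket0 au Cx Ux oW Wx (smoothB oW Ck Cv'w')).
      move=> z Cz [Uz Vz]; have [_ kE _ _] := ak.
      by rewrite kE//= (brP _ _ _ _ _ _ Cv Cw oU Cz Uz av aw) subrr.
    move=> t Dt; rewrite (differentialB oW Wx Ck Cv'w') pairingBr.
    rewrite (adapted_bracket_invariant oU Cx Ux av aw Dt) subr0.
    by have [_ _ _ kD] := ak; apply: kD => //; exact: CA.
  rewrite (nested f g h f' g' h')// (nested g h f g' h' f')// (nested h f g h' f' g')//.
  by apply: (pbracket_jacobi poissonPi oU Ux); [case: af|case: ag|case: ah].
- move=> f g h Cf Cg Ch; apply/funext => y; have [x Cx <-] := surj y.
  have [U [f' [g' [h' [oU Ux af ag ah]]]]] := common_extensions Cf Cg Ch Cx.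
  have Cgh : smooth setT (fun x => g x * h x) by exact: smoothM openT _ _.
  rewrite (brP _ _ U _ _ _ Cf Cgh oU Cx Ux af (adapted_mul oU ag ah)).
  rewrite (brP _ _ U _ _ _ Cf Cg oU Cx Ux af ag) (brP _ _ U _ _ _ Cf Ch oU Cx Ux af ah).
  have [Cg' gE _ _] := ag; have [Ch' hE _ _] := ah.
  by rewrite (pbracketMr _ _ Ux Cg' Ch') gE// hE.
Qed.

End Reduction.

Unset Implicit Arguments.

Theorem theorem13 (R : realType) (m : nat) (M : manifold R m)
    (Pi : M -> 'M[R]_m)
    (dimC dimA rankE rankF rankD : nat)
    (C A : set M) (E F D : M -> set 'rV[R]_m)
    (n : nat) (Q : manifold R n) (q : M -> Q) :
  poisson_bivector Pi ->
  submanifold dimC C ->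
  subbundle rankE C E ->
  (forall x, C x -> F x = tangent dimC C x `&` E x) ->
  tangent_distribution dimC rankF C F ->
  involutive_distribution C F ->
  subbundle rankD C D ->
  (forall x, C x -> F x `<=` D x /\ D x `<=` E x) ->
  (forall x, C x -> forall alpha : 'rV[R]_m,
     (forall v, E x v -> pairing v alpha = 0) ->
     [set u + v | u in tangent dimC C x & v in D x] (sharp Pi x alpha)) ->
  submanifold dimA A ->
  C `<=` A ->
  (forall x, C x ->
     tangent dimA A x = [set u + v | u in tangent dimC C x & v in D x]) ->
  tangent_distribution dimA rankD A D ->
  integrable_distribution dimA rankD A D ->
  (forall p, C p -> exists (U : set M) (X : 'I_rankD -> M -> 'rV[R]_m),
     [/\ open U, U p, local_frame A D U X &
         forall i x, C x -> U x ->
           wedge_tangent (E x) (lie_derivative (X i) Pi x)]) ->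
  leaf_space dimC rankF C F q ->
  inherits_poisson Pi C A E D q.
Proof.
move=> poissonPi subC bunE FE [bunF _] _ bunD FDE sharpE subA CA TA [_ DA] intD.
move=> frames leaves.
apply: (reduction poissonPi subC FDE sharpE CA TA frames leaves) => f p.
exact: (adapted_extension_exists subC bunE FE bunF bunD FDE subA CA TA DA intD leaves).
Qed.
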